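(* For every $x\in\mathbb{R}^d$, the sequence $(\{nx\})_{n\ge1}$ is uniformly eutaxic in $(0,1)^d$ if and only if $x$ is badly approximable.
   Context: Fix a norm $|\cdot|$ on $\mathbb{R}^d$; $\mathcal{L}^d$ is Lebesgue measure; $|\cdot|_\infty$ is the supremum norm; $\{z\}$ denotes the coordinatewise fractional part. $\mathrm{P}_d$ is the set of real sequences $(r_n)_{n\ge1}$ with $r_{n+1}\le r_n$, $r_n\to0$ and $\sum_nr_n^d=\infty$. A sequence $(x_n)$ in $\mathbb{R}^d$ is uniformly eutaxic in an open set $U$ if for every $(r_n)\in\mathrm{P}_d$, $\mathcal{L}^d$-almost every $y\in U$ satisfies $|y-x_n|<r_n$ for infinitely many $n$. A point $x\in\mathbb{R}^d$ is badly approximable if there is $\varepsilon>0$ such that $|x-p/q|_\infty\ge\varepsilon/q^{1+1/d}$ for all $(p,q)\in\mathbb{Z}^d\times\mathbb{N}$. *)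

(* Defs.v *)
(* classical reals. Points of R^d are modelled as functions
   nat -> R of which only the coordinates i < d are used. *)
From Stdlib Require Import Reals Lra Lia ZArith.
Open Scope R_scope.

Definition vec := nat -> R.

Definition same_pt (d : nat) (x y : vec) : Prop := forall i, (i < d)%nat -> x i = y i.

Definition vsub (x y : vec) : vec := fun i => x i - y i.
Definition vscal (c : R) (x : vec) : vec := fun i => c * x i.
Definition vadd (x y : vec) : vec := fun i => x i + y i.

Definition is_norm (d : nat) (N : vec -> R) : Prop :=
  (forall x y, same_pt d x y -> N x = N y) /\
  (forall x, 0 <= N x) /\
  (forall x, N x = 0 -> same_pt d x (fun _ => 0)) /\
  (forall c x, N (vscal c x) = Rabs c * N x) /\
  (forall x y, N (vadd x y) <= N x + N y).

Fixpoint supnorm (d : nat) (x : vec) : R :=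
  match d with
  | O => 0
  | S k => Rmax (supnorm k x) (Rabs (x k))
  end.

Definition vfrac (x : vec) : vec := fun i => frac_part (x i).

Fixpoint psum1 (u : nat -> R) (M : nat) : R :=
  match M with
  | O => 0
  | S k => psum1 u k + u (S k)
  end.

(* The class P_d (sequences indexed by n >= 1; the value at 0 is irrelevant). *)
Definition in_Pd (d : nat) (r : nat -> R) : Prop :=
  (forall n, (1 <= n)%nat -> r (S n) <= r n) /\
  Un_cv r 0 /\
  (forall M : R, exists K : nat, M < psum1 (fun n => r n ^ d) K).

Fixpoint box_vol (d : nat) (a b : vec) : R :=
  match d with
  | O => 1
  | S k => box_vol k a b * (b k - a k)
  end.

Definition in_box (d : nat) (a b : vec) (y : vec) : Prop :=
  forall i, (i < d)%nat -> a i < y i < b i.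

Definition leb_null (d : nat) (S : vec -> Prop) : Prop :=
  forall eps : R, 0 < eps ->
    exists a b : nat -> vec,
      (forall k i, (i < d)%nat -> a k i <= b k i) /\
      (forall K, psum1 (fun k => box_vol d (a (pred k)) (b (pred k))) K <= eps) /\
      (forall y, S y -> exists k, in_box d (a k) (b k) y).

Definition ae_in (d : nat) (U : vec -> Prop) (P : vec -> Prop) : Prop :=
  leb_null d (fun y => U y /\ ~ P y).

Definition unif_eutaxic (d : nat) (N : vec -> R) (x : nat -> vec) (U : vec -> Prop) : Prop :=
  forall r : nat -> R, in_Pd d r ->
    ae_in d U (fun y => forall M : nat, exists n : nat,
                  (M <= n)%nat /\ (1 <= n)%nat /\ N (vsub y (x n)) < r n).

Definition unit_cube (d : nat) (y : vec) : Prop := forall i, (i < d)%nat -> 0 < y i < 1.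

Definition bad_approx (d : nat) (x : vec) : Prop :=
  exists eps : R, 0 < eps /\
    forall (p : nat -> Z) (q : nat), (1 <= q)%nat ->
      eps / Rpower (INR q) (1 + 1 / INR d)
        <= supnorm d (vsub x (fun i => IZR (p i) / INR q)).

(* Main.v *)
(* If [x] is badly approximable, pigeonholing on the points [i y + n x] shows that every dyadic cell
   of side [2^-k] contains some [{n x}] with [n] in any prescribed window of length [A 2^(d k)].  Each
   such cell therefore loses the subcell of level about [- log2 r_n] around that point.  Refining the
   remaining dyadic cells level by level, level [k] carries at least half of the remaining mass and
   loses a proportion comparable to [2^(d k) r_(2^(d k))^d]; the sum of these diverges, so the set of
   points missed by all balls of index at least [M] is null.

   If [x] is not badly approximable, there are [q] with [|q x - p| < s / u^(d+1)], [s = q^(-1/d)], for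
   every [u].  The first [T = u^d q] points [{n x}] then form [q] clusters of radius [rho = s / u], so
   that the balls of radius [rho] around them have total volume [O(1/u)] although [T rho^d = 1].
   Concatenating such blocks for a fast increasing sequence of [u] gives an element of [P_d] whose
   limsup set is null by Borel-Cantelli. *)
Require Import Defs.
From Stdlib Require Import Reals Lra Lia ZArith Arith List Classical ClassicalEpsilon.
Import ListNotations.
Open Scope R_scope.

(** * Sums and coverings by boxes *)

(** Null sets exist here only through countable coverings by boxes, and the balls around orbit
    points are not independent, so no probabilistic converse of Borel-Cantelli is at hand. The
    substitute is deterministic: the orbit meets every cell in every window of indices, hence also
    the cells that survived earlier removals. Since [r] decreases, the radius at the end of a window
    bounds from below all radii in it, and [sum r_n ^ d] becomes a condensed sum.

    The pigeonhole only brings some bounded multiple [j y] close to the orbit; a factorial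
    denominator absorbs [j]. Removing a subcell far below the level of its cell leaves siblings on
    many levels, so the refinement must also control how the mass is spread over levels, or level
    [k] could carry too little of it.

    In the other direction a null limsup set contradicts eutaxy only because the cube is not null.
    For coverings by infinitely many boxes this needs an argument, here a bisection that finds an
    uncovered point. *)

Lemma psum1_le (f g : nat -> R) (K : nat) :
  (forall k, f k <= g k) -> psum1 f K <= psum1 g K.
Proof. intros H; induction K as [|K IH]; simpl; [lra|]; specialize (H (S K)); lra. Qed.

Lemma psum1_ext (f g : nat -> R) (K : nat) :
  (forall k, (1 <= k <= K)%nat -> f k = g k) -> psum1 f K = psum1 g K.
Proof.
  induction K as [|K IH]; simpl; intros H; [reflexivity|].
  rewrite (H (S K)) by lia. rewrite IH; [reflexivity|]. intros k hk; apply H; lia.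
Qed.

Lemma psum1_plus (f g : nat -> R) (K : nat) :
  psum1 (fun k => f k + g k) K = psum1 f K + psum1 g K.
Proof. induction K as [|K IH]; simpl; lra. Qed.

Lemma psum1_scal (c : R) (f : nat -> R) (K : nat) :
  psum1 (fun k => c * f k) K = c * psum1 f K.
Proof. induction K as [|K IH]; simpl; lra. Qed.

Lemma psum1_mono (f : nat -> R) (K K' : nat) :
  (forall k, (1 <= k)%nat -> 0 <= f k) -> (K <= K')%nat -> psum1 f K <= psum1 f K'.
Proof.
  intros H; induction 1 as [|K' _ IH]; simpl; [lra|].
  specialize (H (S K')); assert (0 <= f (S K')) by (apply H; lia); lra.
Qed.

Lemma psum1_term (f : nat -> R) (K k : nat) :
  (forall j, (1 <= j)%nat -> 0 <= f j) -> (1 <= k <= K)%nat -> f k <= psum1 f K.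
Proof.
  intros H hk. apply Rle_trans with (psum1 f k); [|apply psum1_mono; auto; lia].
  destruct k as [|k]; [lia|]; simpl.
  pose proof (psum1_mono f 0 k H (Nat.le_0_l k)) as H0; simpl in H0; lra.
Qed.

Definition lsum {A : Type} (f : A -> R) (L : list A) : R := fold_right Rplus 0 (map f L).

Lemma lsum_cons {A} (f : A -> R) a L : lsum f (a :: L) = f a + lsum f L.
Proof. reflexivity. Qed.

Lemma lsum_app {A} (f : A -> R) L L' : lsum f (L ++ L') = lsum f L + lsum f L'.
Proof.
  induction L as [|a L IH]; [unfold lsum; simpl; lra|].
  simpl app; rewrite !lsum_cons, IH; lra.
Qed.

Lemma lsum_const {A} (f : A -> R) (c : R) L :
  (forall a, In a L -> f a = c) -> lsum f L = INR (length L) * c.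
Proof.
  induction L as [|a L IH]; intros H; [unfold lsum; simpl; lra|].
  rewrite lsum_cons, IH by (intros; apply H; right; auto).
  rewrite (H a) by (left; auto). simpl length; rewrite S_INR; lra.
Qed.

Lemma lsum_nonneg {A} (f : A -> R) L : (forall a, In a L -> 0 <= f a) -> 0 <= lsum f L.
Proof.
  induction L as [|a L IH]; intros H; [unfold lsum; simpl; lra|].
  rewrite lsum_cons. assert (0 <= f a) by (apply H; left; auto).
  assert (0 <= lsum f L) by (apply IH; intros; apply H; right; auto). lra.
Qed.

Lemma lsum_map {A B} (g : A -> B) (f : B -> R) L : lsum f (map g L) = lsum (fun a => f (g a)) L.
Proof. unfold lsum; rewrite map_map; reflexivity. Qed.

Lemma lsum_firstn {A} (f : A -> R) (x0 : A) (L : list A) (K : nat) :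
  (forall a, In a L -> 0 <= f a) -> f x0 = 0 ->
  psum1 (fun k => f (nth (pred k) L x0)) K <= lsum f L.
Proof.
  intros H H0. revert L H; induction K as [|K IH] using nat_ind; intros L H.
  - simpl; apply lsum_nonneg; auto.
  (* [psum1] grows at its end whereas a list is consumed from its head; [E] splits off the first
     term instead of the last. *)
  - assert (E : psum1 (fun k => f (nth (pred k) L x0)) (S K)
              = f (nth 0 L x0) + psum1 (fun k => f (nth (pred k) (tl L) x0)) K).
    { clear IH. induction K as [|K IH]; [simpl; lra|].
      change (psum1 (fun k => f (nth (pred k) L x0)) (S (S K)))
        with (psum1 (fun k => f (nth (pred k) L x0)) (S K) + f (nth (S K) L x0)).
      rewrite IH. simpl psum1. simpl pred.
      replace (nth (S K) L x0) with (nth K (tl L) x0); [lra|].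
      destruct L; simpl; auto. destruct K; auto. }
    rewrite E. destruct L as [|a L].
    + specialize (IH nil H). change (nth 0 [] x0) with x0. rewrite H0, Rplus_0_l. exact IH.
    + specialize (IH L (fun b hb => H b (or_intror hb))).
      rewrite lsum_cons. apply Rplus_le_compat_l. exact IH.
Qed.

Definition box := (vec * vec)%type.
Definition wf_box (d : nat) (B : box) : Prop := forall i, (i < d)%nat -> fst B i <= snd B i.
Definition bvol (d : nat) (B : box) : R := box_vol d (fst B) (snd B).

Lemma box_vol_nonneg (d : nat) (a b : vec) :
  (forall i, (i < d)%nat -> a i <= b i) -> 0 <= box_vol d a b.
Proof.
  induction d as [|d IH]; simpl; intros H; [lra|].
  apply Rmult_le_pos; [apply IH; intros; apply H; lia|]. specialize (H d); assert (a d <= b d) by (apply H; lia); lra.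
Qed.

Lemma box_vol_cube (d : nat) (a b : vec) (h : R) :
  (forall i, (i < d)%nat -> b i - a i = h) -> box_vol d a b = h ^ d.
Proof.
  induction d as [|d IH]; simpl; intros H; [reflexivity|].
  rewrite IH by (intros; apply H; lia). rewrite H by lia. ring.
Qed.

Fixpoint concat_upto {A} (L : nat -> list A) (m : nat) : list A :=
  match m with O => [] | S k => concat_upto L k ++ L k end.

Lemma concat_upto_nth {A} (L : nat -> list A) (x0 : A) (m m' g : nat) :
  (m <= m')%nat -> (g < length (concat_upto L m))%nat ->
  nth g (concat_upto L m') x0 = nth g (concat_upto L m) x0.
Proof.
  induction 1 as [|m' hm IH]; intros hg; [reflexivity|].
  simpl. rewrite app_nth1; auto.
  enough (forall n n' : nat, (n <= n')%nat -> (length (concat_upto L n) <= length (concat_upto L n'))%nat)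
    as HH by (specialize (HH m m' hm); lia).
  induction 1; simpl; [lia|]. rewrite length_app; lia.
Qed.

Lemma concat_upto_length {A} (L : nat -> list A) (m : nat) :
  (forall k, L k <> []) -> (m <= length (concat_upto L m))%nat.
Proof.
  intros H; induction m as [|m IH]; simpl; [lia|]. rewrite length_app.
  specialize (H m); destruct (L m); [congruence|]; simpl; lia.
Qed.

(* Every list is padded with a degenerate box, so that the g-th box overall already occurs
   in the first g + 1 lists. *)
Lemma cover_of_lists (d : nat) (L : nat -> list box) (eps : R) :
  (1 <= d)%nat ->
  (forall m B, In B (L m) -> wf_box d B) ->
  (forall K, psum1 (fun m => lsum (bvol d) (L (pred m))) K <= eps) ->
  exists a b : nat -> vec,
    (forall k i, (i < d)%nat -> a k i <= b k i) /\
    (forall K, psum1 (fun k => box_vol d (a (pred k)) (b (pred k))) K <= eps) /\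
    (forall y m B, In B (L m) -> in_box d (fst B) (snd B) y ->
       exists k, in_box d (a k) (b k) y).
Proof.
  intros hd hwf hvol.
  set (B0 := ((fun _ => 0), (fun _ => 0)) : box).
  set (L' := fun m => B0 :: L m).
  assert (hB0 : bvol d B0 = 0).
  { unfold bvol. destruct d as [|d]; [lia|]. simpl; ring. }
  assert (hne : forall k, L' k <> []) by (intros k; unfold L'; congruence).
  assert (hwf' : forall m B, In B (concat_upto L' m) -> wf_box d B).
  { induction m as [|m IH]; simpl; intros B hB; [contradiction|].
    apply in_app_or in hB; destruct hB as [hB|[hB|hB]]; [auto| |eauto].
    subst B; intros i _; simpl; lra. }
  set (s := fun k => nth k (concat_upto L' (S k)) B0).
  assert (hs : forall k, wf_box d (s k)).
  { intros k; unfold s. apply (hwf' (S k)), nth_In.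
    pose proof (concat_upto_length L' (S k) hne); lia. }
  exists (fun k => fst (s k)), (fun k => snd (s k)). split; [|split].
  - intros k i hi; apply hs; auto.
  - intros K.
    rewrite (psum1_ext _ (fun k => bvol d (nth (pred k) (concat_upto L' K) B0))).
    2:{ intros k hk. unfold s, bvol. replace (S (pred k)) with k by lia.
        rewrite (concat_upto_nth L' B0 k K) by
          (try lia; pose proof (concat_upto_length L' k hne); lia). reflexivity. }
    eapply Rle_trans; [apply lsum_firstn; auto|].
    { intros B hB; apply box_vol_nonneg; apply (hwf' K); auto. }
    eapply Rle_trans; [|apply (hvol K)]. apply Req_le.
    clear -hB0. induction K as [|K IH]; [reflexivity|].
    simpl. unfold L' at 2. rewrite lsum_app, lsum_cons, IH, hB0; lra.
  - intros y m B hB hy.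
    destruct (In_nth (concat_upto L' (S m)) B B0) as [g [hg1 hg2]].
    { simpl. apply in_or_app; right; right; auto. }
    exists g. replace (s g) with B; [auto|].
    unfold s. rewrite <- hg2. destruct (le_lt_dec m g) as [h|h].
    + symmetry; apply concat_upto_nth; auto; lia.
    + apply concat_upto_nth; [lia|]. pose proof (concat_upto_length L' (S g) hne); lia.
Qed.

(** * The unit cube is not null *)

(** Length of the intersection of the intervals with ends [a], [b] and [l], [u]; the outer [Rmax]
    gives 0 when they are disjoint. *)
Definition ilen (a b l u : R) : R := Rmax 0 (Rmin b u - Rmax a l).

Lemma ilen_split (a b l m u : R) : l <= m <= u -> ilen a b l u = ilen a b l m + ilen a b m u.
Proof. intros H; unfold ilen, Rmax, Rmin; repeat destruct Rle_dec; lra. Qed.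

Lemma ilen_nonneg (a b l u : R) : 0 <= ilen a b l u.
Proof. apply Rmax_l. Qed.

Lemma ilen_le (a b l u : R) : a <= b -> ilen a b l u <= b - a.
Proof. intros H; unfold ilen, Rmax, Rmin; repeat destruct Rle_dec; lra. Qed.

Lemma ilen_full (a b l u : R) : a <= l -> u <= b -> l <= u -> ilen a b l u = u - l.
Proof. intros; unfold ilen, Rmax, Rmin; repeat destruct Rle_dec; lra. Qed.

Definition ind (P : Prop) (c : R) : R := if excluded_middle_informative P then c else 0.

Lemma ind_true (P : Prop) (c : R) : P -> ind P c = c.
Proof. intros h; unfold ind; destruct excluded_middle_informative; tauto. Qed.

Lemma ind_false (P : Prop) (c : R) : ~ P -> ind P c = 0.
Proof. intros h; unfold ind; destruct excluded_middle_informative; tauto. Qed.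

Lemma ind_nonneg (P : Prop) (c : R) : 0 <= c -> 0 <= ind P c.
Proof. intros h; unfold ind; destruct excluded_middle_informative; lra. Qed.

(* Bisection: one of the two halves inherits the bound on the average of the step function. *)
Lemma point_below_average (c : nat -> R) (a b : nat -> R) (l u kap : R) :
  l < u -> (forall k, 0 <= c k) ->
  (forall K, psum1 (fun k => c k * ilen (a k) (b k) l u) K <= kap * (u - l)) ->
  exists y, l <= y <= u /\ forall K, psum1 (fun k => ind (a k < y < b k) (c k)) K <= kap.
Proof.
  intros hlu hc H.
  set (good := fun p : R * R =>
    forall K, psum1 (fun k => c k * ilen (a k) (b k) (fst p) (snd p)) K <= kap * (snd p - fst p)).
  set (mid := fun p : R * R => (fst p + snd p) / 2).
  set (next := fun p : R * R =>
    if excluded_middle_informative (good (fst p, mid p)) then (fst p, mid p) else (mid p, snd p)).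
  set (s := fun n => Nat.iter n next (l, u)).
  assert (hs : forall n, good (s n) /\ snd (s n) - fst (s n) = (u - l) / 2 ^ n
      /\ fst (s n) <= fst (s (S n)) /\ snd (s (S n)) <= snd (s n)).
  { assert (hstep : forall p, fst p < snd p -> good p ->
      good (next p) /\ snd (next p) - fst (next p) = (snd p - fst p) / 2
      /\ fst p <= fst (next p) /\ snd (next p) <= snd p).
    { intros p hp gp. unfold next. destruct excluded_middle_informative as [g|g].
      - simpl; unfold mid; repeat split; auto; lra.
      - split; [|simpl; unfold mid; repeat split; lra].
        (* If the bound fails on both halves, at truncations [K'] and [K], both failures persist at
           the larger truncation because the terms are nonnegative, and they add up to a failure on
           the whole interval. *)
        intros K. apply Rnot_lt_le; intros hK. apply not_all_ex_not in g as [K' hK'].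
        apply Rnot_le_lt in hK'. simpl in *.
        assert (hm : forall lo hi K K', (K <= K')%nat ->
           psum1 (fun k => c k * ilen (a k) (b k) lo hi) K
           <= psum1 (fun k => c k * ilen (a k) (b k) lo hi) K').
        { intros lo hi K0 K0' h0; apply psum1_mono; auto.
          intros; apply Rmult_le_pos; auto; apply ilen_nonneg. }
        pose proof (hm (fst p) (mid p) K' (Nat.max K K') ltac:(lia)).
        pose proof (hm (mid p) (snd p) K (Nat.max K K') ltac:(lia)).
        specialize (gp (Nat.max K K')).
        rewrite (psum1_ext _ (fun k => c k * ilen (a k) (b k) (fst p) (mid p)
             + c k * ilen (a k) (b k) (mid p) (snd p))) in gp.
        2:{ intros k _. rewrite (ilen_split (a k) (b k) (fst p) (mid p) (snd p)); [ring|].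
            unfold mid; lra. }
        rewrite psum1_plus in gp. lra. }
    assert (h0 : forall n, good (s n) /\ snd (s n) - fst (s n) = (u - l) / 2 ^ n).
    { induction n as [|n [IH1 IH2]].
      - split; [exact H|simpl; lra].
      - assert (fst (s n) < snd (s n)).
        { assert (0 < (u - l) / 2 ^ n) by (apply Rdiv_lt_0_compat; [lra|apply pow_lt; lra]). lra. }
        destruct (hstep (s n)) as [h1 [h2 _]]; auto. split; [exact h1|].
        change (s (S n)) with (next (s n)). rewrite h2, IH2. simpl; field. apply pow_nonzero; lra. }
    intros n; destruct (h0 n) as [h1 h2]; split; [auto|split; [auto|]].
    apply hstep; auto.
    assert (0 < (u - l) / 2 ^ n) by (apply Rdiv_lt_0_compat; [lra|apply pow_lt; lra]). lra. }
  assert (hpos : forall n, fst (s n) < snd (s n)).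
  { intros n. assert (0 < (u - l) / 2 ^ n) by (apply Rdiv_lt_0_compat; [lra|apply pow_lt; lra]).
    destruct (hs n) as [_ [h _]]; lra. }
  assert (hnest : forall n k, fst (s n) <= fst (s (n + k)%nat) /\ snd (s (n + k)%nat) <= snd (s n)).
  { intros n; induction k as [|k IH]; [rewrite Nat.add_0_r; lra|].
    rewrite Nat.add_succ_r. destruct (hs (n + k)%nat) as [_ [_ h]]; lra. }
  assert (hcross : forall n m, fst (s n) <= snd (s m)).
  { intros n m. pose proof (hnest n m). pose proof (hnest m n).
    rewrite (Nat.add_comm m n) in H1. pose proof (hpos (n + m)%nat). lra. }
  destruct (completeness (fun t => exists n, t = fst (s n))) as [y [hy1 hy2]].
  { exists u; intros t [n ->]. apply (hcross n 0%nat). }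
  { exists l; exists 0%nat; reflexivity. }
  assert (hy : forall n, fst (s n) <= y <= snd (s n)).
  { intros n; split; [apply hy1; exists n; auto|].
    apply hy2. intros t [m ->]; apply hcross. }
  exists y. split; [apply (hy 0%nat)|].
  intros K.
  (* The intervals are open and only finitely many are considered, so a short enough bisection
     interval lies inside each one that contains [y]. There [ilen] is the full length, and the
     average bounds the sum at [y]. *)
  assert (hn : exists n0, forall n, (n0 <= n)%nat -> forall k, (k <= K)%nat ->
     a k < y < b k -> a k <= fst (s n) /\ snd (s n) <= b k).
  { induction K as [|K [n0 IH]] using nat_ind.
    all: assert (hk : forall k, exists n1, forall n, (n1 <= n)%nat ->
       a k < y < b k -> a k <= fst (s n) /\ snd (s n) <= b k).
    1,3: intros k; destruct (classic (a k < y < b k)) as [h|h]; [|exists 0%nat; tauto];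
      set (e := Rmin (y - a k) (b k - y));
      assert (he : 0 < e) by (unfold e, Rmin; destruct Rle_dec; lra);
      assert (he' : e <= y - a k /\ e <= b k - y) by (unfold e, Rmin; destruct Rle_dec; lra);
      destruct (pow_lt_1_zero (1/2) ltac:(rewrite Rabs_right; lra) (e / (u - l))
           ltac:(apply Rdiv_lt_0_compat; lra)) as [n1 hn1];
      exists n1; intros n h1 _; specialize (hn1 n h1);
      rewrite Rabs_right in hn1 by (apply Rle_ge, pow_le; lra);
      destruct (hs n) as [_ [h2 _]]; specialize (hy n);
      assert ((u - l) / 2 ^ n < e); [|lra];
      replace ((u - l) / 2 ^ n) with ((u - l) * (1 / 2) ^ n)
        by (unfold Rdiv; rewrite Rmult_1_l, pow_inv; reflexivity);
      apply (Rmult_lt_compat_l (u - l)) in hn1; [|lra];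
      replace ((u - l) * (e / (u - l))) with e in hn1 by (field; lra); lra.
    - destruct (hk 0%nat) as [n1 hn1]; exists n1; intros n h k h'.
      replace k with 0%nat by lia; auto.
    - destruct (hk (S K)) as [n1 hn1]; exists (Nat.max n0 n1); intros n h k h'.
      destruct (Nat.eq_dec k (S K)) as [->|hne]; [apply hn1; lia|apply IH; lia]. }
  destruct hn as [n0 hn]. specialize (hn n0 (le_n _)).
  destruct (hs n0) as [hg _]. specialize (hg K). specialize (hpos n0).
  apply Rmult_le_reg_r with (snd (s n0) - fst (s n0)); [lra|].
  eapply Rle_trans; [|exact hg].
  rewrite Rmult_comm, <- psum1_scal.
  assert (hh : forall K', (K' <= K)%nat ->
    psum1 (fun k => (snd (s n0) - fst (s n0)) * ind (a k < y < b k) (c k)) K'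
    <= psum1 (fun k => c k * ilen (a k) (b k) (fst (s n0)) (snd (s n0))) K').
  { induction K' as [|K' IH]; simpl; intros hK'; [lra|]. specialize (IH ltac:(lia)).
    apply Rplus_le_compat; auto.
    destruct (classic (a (S K') < y < b (S K'))) as [h|h].
    - rewrite ind_true by auto. destruct (hn (S K') hK' h).
      rewrite ilen_full by lra. lra.
    - rewrite ind_false by auto. rewrite Rmult_0_r. apply Rmult_le_pos; auto; apply ilen_nonneg. }
  apply hh; auto.
Qed.

(** Fubini one coordinate at a time: the last coordinate [t] is chosen by bisection with weights
    [c k] times the volume of the other sides, then boxes whose last side misses [t] get weight 0.
    The bisection may end at an endpoint, hence the range from 1/4 to 3/4 inside the open cube; its
    length 1/2 accounts for [2 ^ d]. *)
Lemma point_below_average_box (d : nat) (a b : nat -> vec) :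
  (forall k i, (i < d)%nat -> a k i <= b k i) ->
  forall (c : nat -> R) (kap : R), (forall k, 0 <= c k) ->
  (forall K, psum1 (fun k => c k * box_vol d (a k) (b k)) K <= kap / 2 ^ d) ->
  exists y, (forall i, (i < d)%nat -> 1/4 <= y i <= 3/4) /\
    forall K, psum1 (fun k => ind (in_box d (a k) (b k) y) (c k)) K <= kap.
Proof.
  induction d as [|d IH]; intros hab c kap hc H.
  - exists (fun _ => 0). split; [intros i hi; lia|]. intros K.
    specialize (H K). simpl in H.
    eapply Rle_trans; [|eapply Rle_trans; [exact H|lra]].
    apply psum1_le. intros k. rewrite ind_true by (intros i hi; lia). lra.
  - destruct (point_below_average (fun k => c k * box_vol d (a k) (b k))
      (fun k => a k d) (fun k => b k d) (1/4) (3/4) (kap / 2 ^ d)) as [t [ht1 ht2]].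
    + lra.
    + intros k; apply Rmult_le_pos; auto. apply box_vol_nonneg; intros; apply hab; lia.
    + intros K. eapply Rle_trans; [apply psum1_le with (g := fun k => c k * box_vol (S d) (a k) (b k))|].
      * intros k. simpl. rewrite Rmult_assoc. apply Rmult_le_compat_l; auto.
        apply Rmult_le_compat_l; [apply box_vol_nonneg; intros; apply hab; lia|].
        apply ilen_le; apply hab; lia.
      * eapply Rle_trans; [apply H|]. apply Req_le. simpl. field. apply pow_nonzero; lra.
    + destruct (IH (fun k i hi => hab k i ltac:(lia)) (fun k => ind (a k d < t < b k d) (c k)) kap)
        as [y [hy1 hy2]].
      * intros k; apply ind_nonneg; auto.
      * intros K. eapply Rle_trans; [|apply (ht2 K)]. apply Req_le, psum1_ext.
        intros k _. unfold ind. destruct excluded_middle_informative; lra.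
      * exists (fun i => if Nat.eq_dec i d then t else y i). split.
        { intros i hi. destruct Nat.eq_dec; auto. apply hy1; lia. }
        intros K. eapply Rle_trans; [|apply (hy2 K)]. apply psum1_le. intros k.
        destruct (classic (in_box (S d) (a k) (b k) (fun i => if Nat.eq_dec i d then t else y i))) as [h|h].
        -- rewrite (ind_true (in_box (S d) _ _ _)) by auto.
           rewrite ind_true.
           ++ rewrite ind_true; [lra|]. specialize (h d ltac:(lia)). cbv beta in h.
              destruct (Nat.eq_dec d d); [auto|congruence].
           ++ intros i hi. specialize (h i ltac:(lia)). cbv beta in h. destruct (Nat.eq_dec i d); [lia|auto].
        -- rewrite ind_false by auto. apply ind_nonneg, ind_nonneg; auto.
Qed.

(** With all weights equal to 1, the sum at [y] counts the boxes containing [y]; a count of at most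
    1/2 is 0. *)
Lemma unit_cube_not_null (d : nat) : ~ leb_null d (unit_cube d).
Proof.
  intros H. destruct (H (1/2 / 2 ^ d)) as [a [b [hab [hv hc]]]].
  { apply Rdiv_lt_0_compat; [lra|apply pow_lt; lra]. }
  destruct (point_below_average_box d (fun k => a (pred k)) (fun k => b (pred k))
     (fun k i hi => hab (pred k) i hi) (fun _ => 1) (1/2)) as [y [hy1 hy2]].
  - intros; lra.
  - intros K. eapply Rle_trans; [|apply (hv K)]. apply psum1_le; intros; lra.
  - destruct (hc y) as [k hk].
    { intros i hi; specialize (hy1 i hi); lra. }
    specialize (hy2 (S k)).
    pose proof (psum1_term (fun k => ind (in_box d (a (pred k)) (b (pred k)) y) 1) (S k) (S k)
      (fun j _ => ind_nonneg _ 1 ltac:(lra)) ltac:(lia)) as h.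
    cbv beta in h. rewrite (ind_true (in_box d (a (pred (S k))) _ y)) in h by exact hk. lra.
Qed.

Lemma leb_null_union (d : nat) (S1 S2 : vec -> Prop) :
  (1 <= d)%nat -> leb_null d S1 -> leb_null d S2 -> leb_null d (fun y => S1 y \/ S2 y).
Proof.
  intros hd H1 H2 eps he.
  destruct (H1 (eps/2) ltac:(lra)) as [a [b [hab [hv hc]]]].
  destruct (H2 (eps/2) ltac:(lra)) as [a' [b' [hab' [hv' hc']]]].
  destruct (cover_of_lists d (fun m => [(a m, b m); (a' m, b' m)]) eps hd) as [u [v [h1 [h2 h3]]]].
  - intros m B [<-|[<-|[]]]; intros i hi; simpl; auto.
  - intros K. specialize (hv K); specialize (hv' K).
    eapply Rle_trans with (psum1 (fun k => box_vol d (a (pred k)) (b (pred k))) K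
       + psum1 (fun k => box_vol d (a' (pred k)) (b' (pred k))) K); [|lra].
    rewrite <- psum1_plus. apply psum1_le; intros k. unfold lsum, bvol; simpl; lra.
  - exists u, v; repeat split; auto.
    intros y [hy|hy]; [destruct (hc y hy) as [k hk]|destruct (hc' y hy) as [k hk]].
    + apply (h3 y k (a k, b k)); simpl; auto.
    + apply (h3 y k (a' k, b' k)); simpl; auto.
Qed.

Lemma leb_null_incl (d : nat) (S1 S2 : vec -> Prop) :
  (forall y, S1 y -> S2 y) -> leb_null d S2 -> leb_null d S1.
Proof.
  intros h H eps he. destruct (H eps he) as [a [b [h1 [h2 h3]]]].
  exists a, b; repeat split; auto.
Qed.

(** * Equivalence with the supremum norm *)

Definition basis (c : nat) : vec := fun i => if Nat.eq_dec i c then 1 else 0.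
Definition trunc (k : nat) (v : vec) : vec := fun i => if lt_dec i k then v i else 0.

Section Norm.
Context (d : nat) (N : vec -> R) (hN : is_norm d N).

Lemma norm_ext (v w : vec) : same_pt d v w -> N v = N w.
Proof. apply hN. Qed.

Lemma norm_pos (v : vec) : 0 <= N v.
Proof. apply hN. Qed.

Lemma norm_vscal (c : R) (v : vec) : N (vscal c v) = Rabs c * N v.
Proof. apply hN. Qed.

Lemma norm_zero (v : vec) : (forall i, (i < d)%nat -> v i = 0) -> N v = 0.
Proof.
  intros h. destruct hN as [h1 [_ [_ [h4 _]]]].
  rewrite (h1 v (vscal 0 v)); [rewrite h4, Rabs_R0; ring|].
  intros i hi; unfold vscal; rewrite h by auto; ring.
Qed.

Lemma norm_triangle (u v w : vec) :
  (forall i, (i < d)%nat -> u i = v i + w i) -> N u <= N v + N w.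
Proof.
  intros h. rewrite (norm_ext u (vadd v w)) by (intros i hi; unfold vadd; auto). apply hN.
Qed.

Lemma norm_scal (u v : vec) (c : R) :
  (forall i, (i < d)%nat -> u i = c * v i) -> N u = Rabs c * N v.
Proof.
  intros h. rewrite (norm_ext u (vscal c v)) by (intros i hi; unfold vscal; auto). apply hN.
Qed.

Lemma norm_upper : exists C, 0 < C /\
  forall v h, 0 < h -> (forall i, (i < d)%nat -> Rabs (v i) <= h) -> N v < C * h.
Proof.
  enough (H : forall k, (k <= d)%nat -> exists C, 0 <= C /\
    forall v h, 0 < h -> (forall i, (i < d)%nat -> Rabs (v i) <= h) -> N (trunc k v) <= C * h).
  { destruct (H d (le_n _)) as [C [hC HC]]. exists (C + 1); split; [lra|].
    intros v h hh hv. apply Rle_lt_trans with (C * h); [|nra].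
    rewrite (norm_ext v (trunc d v)); auto.
    intros i hi; unfold trunc; destruct lt_dec; auto; lia. }
  induction k as [|k IH]; intros hk.
  - exists 0; split; [lra|]. intros v h _ _. rewrite norm_zero; [lra|].
    intros i _; unfold trunc; destruct lt_dec; auto; lia.
  - destruct (IH ltac:(lia)) as [C [hC HC]].
    exists (C + N (basis k)). split; [pose proof (norm_pos (basis k)); lra|].
    intros v h hh hv.
    apply Rle_trans with (N (trunc k v) + N (vscal (v k) (basis k))).
    { apply norm_triangle. intros i hi. unfold trunc, vscal, basis.
      repeat destruct lt_dec; destruct Nat.eq_dec; try lia; subst; ring. }
    rewrite norm_vscal.
    specialize (HC v h hh hv). specialize (hv k ltac:(lia)).
    pose proof (norm_pos (basis k)). nra.
Qed.

Lemma Un_cv_dist_le (u : nat -> R) (l B : R) (n : nat) :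
  Un_cv u l -> (forall m, (n <= m)%nat -> Rabs (u n - u m) <= B) -> Rabs (u n - l) <= B.
Proof.
  intros hu h. apply Rnot_lt_le; intros hlt.
  destruct (hu (Rabs (u n - l) - B) ltac:(lra)) as [m0 hm0].
  specialize (hm0 (Nat.max m0 n) ltac:(lia)). specialize (h (Nat.max m0 n) ltac:(lia)).
  unfold Rdist in hm0.
  pose proof (Rabs_triang (u n - u (Nat.max m0 n)) (u (Nat.max m0 n) - l)).
  replace (u n - u (Nat.max m0 n) + (u (Nat.max m0 n) - l)) with (u n - l) in H by ring. lra.
Qed.

(* By completeness, [basis k] stays at positive distance from the span of the first [k] vectors. *)
Lemma basis_dist_span (k : nat) (C : R) : (k < d)%nat -> 0 <= C ->
  (forall v, (forall i, (k <= i)%nat -> v i = 0) -> forall i, (i < k)%nat -> Rabs (v i) <= C * N v) ->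
  exists del, 0 < del /\
    forall w, (forall i, (k <= i)%nat -> w i = 0) -> del <= N (vadd (basis k) w).
Proof.
  intros hk hC HC.
  destruct norm_upper as [C2 [hC2 HC2]].
  apply NNPP; intros hno.
  assert (hw : forall n, exists w : vec, (forall i, (k <= i)%nat -> w i = 0) /\
     N (vadd (basis k) w) < / (INR n + 1)).
  { intros n. apply NNPP; intros hn. apply hno. exists (/ (INR n + 1)).
    split; [apply Rinv_0_lt_compat; pose proof (pos_INR n); lra|].
    intros w hw. apply Rnot_lt_le; intros hlt. apply hn; exists w; auto. }
  apply choice in hw; destruct hw as [w hw].
  assert (hdec : forall n m, (n <= m)%nat -> / (INR m + 1) <= / (INR n + 1)).
  { intros n m h. apply Rinv_le_contravar; [pose proof (pos_INR n); lra|].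
    apply le_INR in h; lra. }
  (* In [w n - w m] the vector [basis k] cancels, so its norm is at most [2 / (n + 1)]; the bound
     already known on the span of the first [k] vectors makes every coordinate a Cauchy sequence. *)
  assert (hd : forall n m i, (n <= m)%nat -> Rabs (w n i - w m i) <= C * (2 * / (INR n + 1))).
  { intros n m i hnm. destruct (hw n) as [hn1 hn2]; destruct (hw m) as [hm1 hm2].
    assert (0 < / (INR n + 1)) by (apply Rinv_0_lt_compat; pose proof (pos_INR n); lra).
    destruct (le_lt_dec k i) as [hi|hi].
    - rewrite hn1, hm1 by auto. rewrite Rminus_0_r, Rabs_R0. nra.
    - eapply Rle_trans; [apply (HC (vsub (w n) (w m))); auto|].
      + intros j hj; unfold vsub; rewrite hn1, hm1 by auto; ring.
      + apply Rmult_le_compat_l; auto.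
        eapply Rle_trans; [apply (norm_triangle _ (vadd (basis k) (w n))
           (vscal (-1) (vadd (basis k) (w m))))|].
        * intros j _; unfold vsub, vadd, vscal; ring.
        * rewrite norm_vscal.
          rewrite Rabs_left by lra. specialize (hdec n m hnm). lra. }
  assert (hinv : forall e, 0 < e -> exists n, / (INR n + 1) < e).
  { intros e he. destruct (archimed_cor1 e he) as [n [h1 h2]]. exists n.
    eapply Rlt_trans; [|exact h1]. apply Rinv_lt_contravar; [|lra].
    apply lt_INR in h2; simpl in h2. nra. }
  assert (hlim : forall i, exists l, Un_cv (fun n => w n i) l).
  { intros i. destruct (R_complete (fun n => w n i)) as [l hl]; [|exists l; auto].
    intros e he. destruct (hinv (e / (2 * (C * 2 + 1)))) as [n0 hn0].
    { apply Rdiv_lt_0_compat; lra. }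
    assert (hb : C * (2 * / (INR n0 + 1)) < e / 2).
    { apply (Rmult_lt_compat_l (C * 2 + 1)) in hn0; [|lra].
      replace ((C * 2 + 1) * (e / (2 * (C * 2 + 1)))) with (e / 2) in hn0 by (field; lra).
      assert (0 < / (INR n0 + 1)) by (apply Rinv_0_lt_compat; pose proof (pos_INR n0); lra).
      nra. }
    exists n0; intros n m hn hm. unfold Rdist.
    pose proof (hd n0 n i hn); pose proof (hd n0 m i hm).
    pose proof (Rabs_triang (w n0 i - w m i) (- (w n0 i - w n i))).
    rewrite Rabs_Ropp in H1.
    replace (w n0 i - w m i + - (w n0 i - w n i)) with (w n i - w m i) in H1 by ring. lra. }
  apply choice in hlim; destruct hlim as [l hl].
  assert (hz : N (vadd (basis k) l) = 0).
  { apply Rle_antisym; [|apply norm_pos]. apply Rnot_lt_le; intros hlt.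
    destruct (hinv (N (vadd (basis k) l) / (2 * (1 + C2 * (C * 2 + 1))))) as [n hn].
    { apply Rdiv_lt_0_compat; nra. }
    set (t := / (INR n + 1)) in *.
    assert (ht : 0 < t) by (apply Rinv_0_lt_compat; pose proof (pos_INR n); lra).
    assert (h1 : N (vadd (basis k) l) <= N (vadd (basis k) (w n)) + N (vsub l (w n))).
    { apply norm_triangle. intros i _; unfold vadd, vsub; ring. }
    assert (h2 : N (vsub l (w n)) < C2 * ((C * 2 + 1) * t)).
    { apply HC2; [nra|]. intros i _. unfold vsub. rewrite <- Rabs_Ropp, Ropp_minus_distr.
      apply Un_cv_dist_le with (u := fun n => w n i); auto.
      intros m hm. eapply Rle_trans; [apply hd; auto|]. fold t. nra. }
    destruct (hw n) as [_ h3]. fold t in h3.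
    apply (Rmult_lt_compat_l (2 * (1 + C2 * (C * 2 + 1)))) in hn; [|nra].
    replace (2 * (1 + C2 * (C * 2 + 1)) * (N (vadd (basis k) l) / (2 * (1 + C2 * (C * 2 + 1)))))
      with (N (vadd (basis k) l)) in hn by (field; nra).
    nra. }
  (* Coordinate [k] vanishes along the sequence and so in the limit, whereas a zero norm would force
     [1 + l k = 0]. *)
  assert (hlk : l k = 0).
  { apply (UL_sequence (fun n => w n k)); auto. intros e he; exists 0%nat; intros n _.
    destruct (hw n) as [h _]. rewrite h by auto. unfold Rdist; rewrite Rminus_0_r, Rabs_R0; auto. }
  apply hN in hz. specialize (hz k hk). unfold vadd, basis in hz.
  destruct Nat.eq_dec; [lra|congruence].
Qed.

(** Induction on the number of coordinates that may be nonzero. The distance [del] of [basis k] from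
    the span of its predecessors controls the last coordinate by [N v / del]; subtracting that
    coordinate costs a multiple of [N v] and leaves a vector to which the induction hypothesis
    applies. *)
Lemma norm_lower : exists C, 0 < C /\ forall v i, (i < d)%nat -> Rabs (v i) <= C * N v.
Proof.
  enough (H : forall k, (k <= d)%nat -> exists C, 0 <= C /\
    forall v, (forall i, (k <= i)%nat -> v i = 0) -> forall i, (i < k)%nat -> Rabs (v i) <= C * N v).
  { destruct (H d (le_n _)) as [C [hC HC]]. exists (C + 1); split; [lra|].
    intros v i hi. pose proof (norm_pos v).
    assert (h : same_pt d v (trunc d v)).
    { intros j hj; unfold trunc; destruct lt_dec; auto; lia. }
    rewrite (h i hi). rewrite (norm_ext _ _ h) in *.
    eapply Rle_trans; [apply HC; auto|nra].
    intros j hj; unfold trunc; destruct lt_dec; auto; lia. }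
  induction k as [|k IH]; intros hk; [exists 0; split; [lra|intros; lia]|].
  destruct (IH ltac:(lia)) as [C [hC HC]].
  destruct (basis_dist_span k C ltac:(lia) hC HC) as [del [hdel Hdel]].
  assert (hlast : forall v : vec, (forall i, (S k <= i)%nat -> v i = 0) -> Rabs (v k) <= / del * N v).
  { intros v hv. destruct (Req_dec (v k) 0) as [h0|h0].
    - rewrite h0, Rabs_R0. apply Rmult_le_pos; [apply Rlt_le, Rinv_0_lt_compat; auto|apply norm_pos].
    - specialize (Hdel (vscal (/ v k) (trunc k v))).
      rewrite (norm_scal v (vadd (basis k) (vscal (/ v k) (trunc k v))) (v k)).
      + assert (del <= N (vadd (basis k) (vscal (/ v k) (trunc k v)))).
        { apply Hdel. intros i hi; unfold vscal, trunc. destruct lt_dec; [lia|ring]. }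
        assert (hp : 0 < Rabs (v k)) by (apply Rabs_pos_lt; auto).
        apply Rmult_le_reg_l with del; auto.
        rewrite <- Rmult_assoc, Rinv_r, Rmult_1_l by lra. nra.
      + intros i _. unfold vadd, basis, vscal, trunc.
        destruct Nat.eq_dec; destruct lt_dec; subst; try lia; try (field; auto).
        rewrite hv by lia. ring. }
  exists (/ del + C * (1 + / del * N (basis k))).
  assert (hid : 0 < / del) by (apply Rinv_0_lt_compat; auto).
  pose proof (norm_pos (basis k)) as hb.
  assert (0 <= / del * N (basis k)) by (apply Rmult_le_pos; lra).
  split; [nra|]. intros v hv i hi. pose proof (norm_pos v) as hv0.
  specialize (hlast v hv).
  destruct (Nat.eq_dec i k) as [->|hne].
  - eapply Rle_trans; [exact hlast|]. apply Rmult_le_compat_r; auto.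
    assert (0 <= C * (1 + / del * N (basis k))) by (apply Rmult_le_pos; lra). lra.
  - specialize (HC (trunc k v)).
    assert (h1 : Rabs (v i) <= C * N (trunc k v)).
    { replace (v i) with (trunc k v i) by (unfold trunc; destruct lt_dec; auto; lia).
      apply HC; [|lia]. intros j hj; unfold trunc; destruct lt_dec; auto; lia. }
    assert (h2 : N (trunc k v) <= N v + N (vscal (- v k) (basis k))).
    { apply norm_triangle. intros j _. unfold trunc, vscal, basis.
      destruct Nat.eq_dec; destruct lt_dec; subst; try lia; try ring. rewrite hv by lia; ring. }
    rewrite norm_vscal in h2. rewrite Rabs_Ropp in h2.
    assert (h3 : N (trunc k v) <= (1 + / del * N (basis k)) * N v) by nra.
    eapply Rle_trans; [exact h1|].
    apply Rle_trans with (C * ((1 + / del * N (basis k)) * N v)); [nra|].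
    assert (0 <= / del * N v) by (apply Rmult_le_pos; lra). lra.
Qed.

End Norm.

(** * Points that are not badly approximable *)

Lemma Rabs_le_bounds (a b : R) : Rabs a <= b -> - b <= a <= b.
Proof. intros h. pose proof (Rle_abs a). pose proof (Rle_abs (- a)). rewrite Rabs_Ropp in H0. lra. Qed.

(** An explicit list, so that counting is taking a length. It enumerates shifts in [{-1, 0, 1}^d]
    ([m = 3]), cells of a grid, and children of a dyadic cell ([m = 2]). *)
Fixpoint digits (m d : nat) : list (nat -> nat) :=
  match d with
  | O => [fun _ => 0%nat]
  | S k => flat_map (fun e => map (fun f i => if Nat.eq_dec i k then e else f i) (digits m k)) (seq 0 m)
  end.

Lemma digits_length (m d : nat) : length (digits m d) = (m ^ d)%nat.
Proof.
  induction d as [|d IH]; [reflexivity|].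
  simpl. rewrite (flat_map_constant_length (c := (m ^ d)%nat)).
  - rewrite length_seq; lia.
  - intros e _; rewrite length_map; auto.
Qed.

Lemma digits_lt (m d : nat) (f : nat -> nat) :
  In f (digits m d) -> forall i, (i < d)%nat -> (f i < m)%nat.
Proof.
  revert f; induction d as [|d IH]; intros f hf i hi; [lia|].
  simpl in hf. apply in_flat_map in hf. destruct hf as [e [he hf]].
  apply in_map_iff in hf. destruct hf as [g [<- hg]]. apply in_seq in he.
  destruct Nat.eq_dec; [lia|]. apply IH; auto; lia.
Qed.

Lemma digits_spec (m d : nat) (f : nat -> nat) :
  (forall i, (i < d)%nat -> (f i < m)%nat) ->
  exists g, In g (digits m d) /\ forall i, (i < d)%nat -> g i = f i.
Proof.
  induction d as [|d IH]; intros hf.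
  - exists (fun _ => 0%nat); split; [left; auto|intros; lia].
  - destruct IH as [g [hg1 hg2]]; [intros; apply hf; lia|].
    exists (fun i => if Nat.eq_dec i d then f d else g i). split.
    + simpl; apply in_flat_map. exists (f d). split; [apply in_seq; specialize (hf d); lia|].
      apply in_map_iff. exists g; auto.
    + intros i hi. destruct Nat.eq_dec; [subst; auto|apply hg2; lia].
Qed.

Lemma supnorm_le (d : nat) (v : vec) (i : nat) : (i < d)%nat -> Rabs (v i) <= supnorm d v.
Proof.
  induction d as [|d IH]; intros hi; [lia|]. simpl.
  destruct (Nat.eq_dec i d) as [->|h]; [apply Rmax_r|].
  eapply Rle_trans; [apply IH; lia|apply Rmax_l].
Qed.

Lemma supnorm_ge (d : nat) (v : vec) (t : R) :
  0 < t -> t <= supnorm d v -> exists i, (i < d)%nat /\ t <= Rabs (v i).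
Proof.
  intros ht; induction d as [|d IH]; simpl; intros h; [lra|].
  unfold Rmax in h; destruct Rle_dec in h.
  - exists d; split; auto.
  - destruct (IH h) as [i [hi1 hi2]]; exists i; split; auto; lia.
Qed.

Lemma Rpower_inv_pow (q : R) (d : nat) : (1 <= d)%nat -> 0 < q -> Rpower q (1 / INR d) ^ d = q.
Proof.
  intros hd hq. assert (0 < INR d) by (apply lt_0_INR; lia).
  rewrite <- Rpower_pow by apply exp_pos. rewrite Rpower_mult.
  replace (1 / INR d * INR d) with 1 by (field; lra). apply Rpower_1; auto.
Qed.

Lemma Rpower_succ (q e : R) : 0 < q -> Rpower q (1 + e) = q * Rpower q e.
Proof. intros hq. rewrite Rpower_plus, Rpower_1; auto. Qed.

(** The failing inequality is multiplied by [q], and [s] is [q ^ (- 1 / d)]. Recording only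
    [INR q * s ^ d = 1] removes real exponents from all later computations. *)
Lemma not_bad_approx (d : nat) (x : vec) : (1 <= d)%nat -> ~ bad_approx d x ->
  forall eps, 0 < eps -> exists (p : nat -> Z) (q : nat) (s : R),
    (1 <= q)%nat /\ 0 < s <= 1 /\ INR q * s ^ d = 1 /\
    forall i, (i < d)%nat -> Rabs (INR q * x i - IZR (p i)) < eps * s.
Proof.
  intros hd hb eps he. apply NNPP; intros hno. apply hb. exists eps; split; auto.
  intros p q hq. apply Rnot_lt_le; intros hlt. apply hno.
  assert (hq0 : 1 <= INR q) by (apply (le_INR 1); auto).
  assert (hd0 : 0 < INR d) by (apply lt_0_INR; lia).
  set (t := Rpower (INR q) (1 / INR d)).
  assert (ht : 1 <= t).
  { unfold t. rewrite <- (Rpower_O (INR q)) at 1 by lra. apply Rle_Rpower; auto.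
    apply Rlt_le, Rdiv_lt_0_compat; lra. }
  exists p, q, (/ t). repeat split; auto.
  - apply Rinv_0_lt_compat; lra.
  - rewrite <- Rinv_1. apply Rinv_le_contravar; lra.
  - rewrite pow_inv. unfold t; rewrite Rpower_inv_pow by (auto; lra). field; lra.
  - intros i hi. rewrite Rpower_succ in hlt by lra. fold t in hlt.
    pose proof (supnorm_le d (vsub x (fun i => IZR (p i) / INR q)) i hi) as h.
    unfold vsub at 1 in h.
    replace (INR q * x i - IZR (p i)) with (INR q * (x i - IZR (p i) / INR q)) by (field; lra).
    rewrite Rabs_mult, (Rabs_right (INR q)) by lra.
    apply Rlt_le_trans with (INR q * (eps / (INR q * t))).
    + apply Rmult_lt_compat_l; lra.
    + apply Req_le. field; lra.
Qed.

Lemma pow_ge_self (u d : nat) : (1 <= d)%nat -> (1 <= u)%nat -> (u <= u ^ d)%nat.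
Proof.
  intros hd hu. destruct d as [|d]; [lia|]. simpl.
  assert (1 <= u ^ d)%nat by (apply Nat.neq_0_lt_0, Nat.pow_nonzero; lia). nia.
Qed.

(* If [q x] is very close to an integer vector, then [{n x}] stays close to [{j x}], up to a shift
   in [{-1, 0, 1}^d], as long as [n] runs through the first terms of the progression [j + q N]. *)
Lemma cluster_cover (d : nat) (N : vec -> R) (x : vec) (C : R) :
  (1 <= d)%nat -> 0 < C -> (forall v i, (i < d)%nat -> Rabs (v i) <= C * N v) ->
  ~ bad_approx d x -> forall u : nat, (1 <= u)%nat ->
  exists (T : nat) (rho : R) (L : list box),
    (u <= T)%nat /\ 0 < rho <= / INR u /\ INR T * rho ^ d = 1 /\
    (forall B, In B L -> wf_box d B) /\
    lsum (bvol d) L <= (6 * (C + 1)) ^ d / INR u /\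
    forall y n, (1 <= n <= T)%nat -> N (vsub y (vfrac (vscal (INR n) x))) < rho ->
      exists B, In B L /\ in_box d (fst B) (snd B) y.
Proof.
  intros hd hC HC hbad u hu.
  assert (hu1 : 1 <= INR u) by (apply (le_INR 1); auto).
  assert (hud : forall k, 0 < INR u ^ k) by (intros; apply pow_lt; lra).
  (* Up to [u ^ d] steps of the progression multiply the error by [u ^ d]; this precision keeps the
     total drift at most [s / u = rho]. *)
  destruct (not_bad_approx d x hd hbad (/ INR u ^ (S d))) as [p [q [s [hq [hs [hsd hp]]]]]].
  { apply Rinv_0_lt_compat; auto. }
  assert (hq1 : 1 <= INR q) by (apply (le_INR 1); auto).
  set (rho := s / INR u).
  assert (hrho : 0 < rho <= / INR u).
  { unfold rho. split; [apply Rdiv_lt_0_compat; lra|].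
    rewrite <- (Rmult_1_l (/ INR u)). apply Rmult_le_compat_r; [|lra].
    apply Rlt_le, Rinv_0_lt_compat; lra. }
  assert (hrho1 : rho <= 1).
  { eapply Rle_trans; [apply hrho|]. rewrite <- Rinv_1. apply Rinv_le_contravar; lra. }
  assert (hrd : INR q * rho ^ d = / INR u ^ d).
  { unfold rho, Rdiv. rewrite Rpow_mult_distr, pow_inv, <- Rmult_assoc, hsd. ring. }
  set (cen := fun (j : nat) (b : nat -> nat) (i : nat) => frac_part (INR (S j) * x i) + INR (b i) - 1).
  (* Half-side [(C + 1) * rho]: [C * rho] for a ball of radius [rho] and [rho] for the drift along
     the progression. The shift is [b i - 1], with digits 0, 1, 2. *)
  set (bx := fun j b => ((fun i => cen j b i - (C + 1) * rho), (fun i => cen j b i + (C + 1) * rho)) : box).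
  exists (u ^ d * q)%nat, rho,
    (flat_map (fun j => map (fun b => bx j b) (digits 3 d)) (seq 0 q)).
  assert (hin : forall B, In B (flat_map (fun j => map (fun b => bx j b) (digits 3 d)) (seq 0 q)) ->
      exists j b, B = bx j b).
  { intros B hB. apply in_flat_map in hB; destruct hB as [j [_ hB]].
    apply in_map_iff in hB; destruct hB as [b [<- _]]; eauto. }
  split; [|split; [exact hrho|split; [|split; [|split]]]].
  - pose proof (pow_ge_self u d hd hu). nia.
  - rewrite mult_INR, pow_INR, Rmult_assoc, hrd. apply Rinv_r. specialize (hud d); lra.
  - intros B hB. destruct (hin B hB) as [j [b ->]]. intros i hi; simpl. nra.
  - rewrite (lsum_const _ ((2 * (C + 1) * rho) ^ d)).
    2:{ intros B hB; destruct (hin B hB) as [j [b ->]]. unfold bvol; simpl.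
        apply box_vol_cube. intros i _; ring. }
    rewrite (flat_map_constant_length (c := (3 ^ d)%nat)), length_seq.
    2:{ intros j _; rewrite length_map, digits_length; auto. }
    rewrite mult_INR, pow_INR, Rpow_mult_distr. replace (INR 3) with 3 by (simpl; ring).
    replace (6 * (C + 1)) with (3 * (2 * (C + 1))) by ring. rewrite (Rpow_mult_distr 3).
    replace (INR q * 3 ^ d * ((2 * (C + 1)) ^ d * rho ^ d))
      with ((3 ^ d * (2 * (C + 1)) ^ d) * (INR q * rho ^ d)) by ring.
    rewrite hrd. apply Rmult_le_compat_l.
    + apply Rmult_le_pos; apply pow_le; lra.
    + apply Rinv_le_contravar; [lra|]. rewrite <- pow_INR. apply le_INR, pow_ge_self; auto.
  - intros y n hn hy.
    set (j := ((n - 1) mod q)%nat). set (m := ((n - 1) / q)%nat).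
    assert (hnm : (n = S j + m * q)%nat).
    { pose proof (Nat.div_mod_eq (n - 1) q). fold j m in H. lia. }
    assert (hj : (j < q)%nat) by (apply Nat.mod_upper_bound; lia).
    assert (hm : (m <= u ^ d)%nat) by nia.
    set (dl := fun i => INR m * (INR q * x i - IZR (p i))).
    assert (hdl : forall i, (i < d)%nat -> Rabs (dl i) <= rho).
    { intros i hi. unfold dl. rewrite Rabs_mult, (Rabs_right (INR m)) by (apply Rle_ge, pos_INR).
      apply le_INR in hm. rewrite pow_INR in hm. specialize (hp i hi).
      apply Rle_trans with (INR u ^ d * (/ INR u ^ S d * s)).
      - apply Rmult_le_compat; try apply pos_INR; try apply Rabs_pos; lra.
      - apply Req_le. unfold rho; simpl. field. specialize (hud d); split; lra. }
    set (z := fun i => (Z.of_nat m * p i - Int_part (INR n * x i) + Int_part (INR (S j) * x i))%Z).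
    assert (hz : forall i, frac_part (INR n * x i) = frac_part (INR (S j) * x i) + dl i + IZR (z i)).
    { intros i. unfold z, dl, frac_part. rewrite plus_IZR, minus_IZR, mult_IZR, <- INR_IZR_INZ.
      replace (INR n) with (INR (S j) + INR m * INR q) at 1
        by (rewrite <- mult_INR, <- plus_INR; f_equal; lia). ring. }
    (* Two fractional parts differ by less than 1 and the drift is at most [rho <= 1], so the
       integer [z i] is strictly between -2 and 2. *)
    assert (hz1 : forall i, (i < d)%nat -> (-1 <= z i <= 1)%Z).
    { intros i hi. specialize (hz i); specialize (hdl i hi). apply Rabs_le_bounds in hdl.
      destruct (base_fp (INR n * x i)); destruct (base_fp (INR (S j) * x i)).
      assert (h1 : -2 < IZR (z i)) by lra. assert (h2 : IZR (z i) < 2) by lra.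
      apply lt_IZR in h1; apply lt_IZR in h2. lia. }
    destruct (digits_spec 3 d (fun i => Z.to_nat (z i + 1))) as [b [hb1 hb2]].
    { intros i hi; specialize (hz1 i hi); lia. }
    exists (bx j b). split.
    + apply in_flat_map. exists j; split; [apply in_seq; lia|]. apply in_map_iff; eauto.
    + intros i hi. simpl. unfold cen. rewrite hb2 by auto. specialize (hz1 i hi).
      rewrite (INR_IZR_INZ (Z.to_nat _)), Z2Nat.id, plus_IZR by lia.
      specialize (HC _ i hi : Rabs (vsub y (vfrac (vscal (INR n) x)) i) <= _).
      unfold vsub at 1, vfrac at 1, vscal at 1 in HC.
      assert (HC' : Rabs (y i - frac_part (INR n * x i)) < C * rho).
      { eapply Rle_lt_trans; [exact HC|]. apply Rmult_lt_compat_l; auto. }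
      apply Rabs_def2 in HC'. rewrite (hz i) in HC'.
      specialize (hdl i hi). apply Rabs_le_bounds in hdl. lra.
Qed.

(** * Radii with a null limsup set *)

Lemma exists_block_index (T : nat -> nat) :
  (forall k, (k <= T k)%nat) ->
  exists idx : nat -> nat, forall n, (n <= T (idx n))%nat /\ forall j, (j < idx n)%nat -> (T j < n)%nat.
Proof.
  intros hT.
  apply (choice (fun n k => (n <= T k)%nat /\ forall j, (j < k)%nat -> (T j < n)%nat)).
  intros n.
  destruct (dec_inh_nat_subset_has_unique_least_element (fun k => (n <= T k)%nat)) as [k [[h1 h2] _]].
  - intros k; lia.
  - exists n; auto.
  - exists k; split; auto. intros j hj. destruct (le_lt_dec n (T j)) as [h|h]; auto.
    specialize (h2 j h); lia.
Qed.

Lemma psum1_half_pow (K : nat) : psum1 (fun k => / 2 ^ k) K = 1 - / 2 ^ K.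
Proof.
  induction K as [|K IH]; [simpl; lra|]. simpl psum1. rewrite IH.
  simpl. field. apply pow_nonzero; lra.
Qed.

Lemma psum1_const_block (f : nat -> R) (c : R) (a b : nat) :
  (a <= b)%nat -> (forall n, (a < n <= b)%nat -> f n = c) ->
  psum1 f b = psum1 f a + INR (b - a) * c.
Proof.
  induction 1 as [|b hab IH]; intros h; [rewrite Nat.sub_diag; simpl; lra|].
  simpl psum1. rewrite IH by (intros; apply h; lia). rewrite (h (S b)) by lia.
  rewrite Nat.sub_succ_l by lia. rewrite S_INR. lra.
Qed.

Lemma eutaxic_bad_approx (d : nat) (hd : (1 <= d)%nat) (N : vec -> R) (hN : is_norm d N) (x : vec) :
  unif_eutaxic d N (fun n => vfrac (vscal (INR n) x)) (unit_cube d) -> bad_approx d x.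
Proof.
  intros heut. apply NNPP; intros hbad.
  destruct (norm_lower d N hN) as [C [hC HC]].
  set (K0 := (6 * (C + 1)) ^ d).
  assert (hK0 : 0 < K0) by (apply pow_lt; lra).
  assert (hblock : forall u : nat, exists t : nat * R * list box, (1 <= u)%nat ->
    (u <= fst (fst t))%nat /\ 0 < snd (fst t) <= / INR u /\ INR (fst (fst t)) * snd (fst t) ^ d = 1 /\
    (forall B, In B (snd t) -> wf_box d B) /\
    lsum (bvol d) (snd t) <= K0 / INR u /\
    forall y n, (1 <= n <= fst (fst t))%nat -> N (vsub y (vfrac (vscal (INR n) x))) < snd (fst t) ->
      exists B, In B (snd t) /\ in_box d (fst B) (snd B) y).
  { intros u. destruct (le_lt_dec 1 u) as [hu|hu].
    - destruct (cluster_cover d N x C hd hC HC hbad u hu) as [T [rho [L h]]].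
      exists (T, rho, L). intros _. exact h.
    - exists (0%nat, 0, []); lia. }
  apply choice in hblock. destruct hblock as [F hF].
  set (T0 := fun u => fst (fst (F u))). set (rho0 := fun u => snd (fst (F u))).
  (* Each argument of the maximum serves one purpose: [2 * T0] makes block ends at least double, so
     that half of each block is new; [up (/ rho0)] makes the radii decrease; [2 ^ S k] makes the
     covering volumes summable. *)
  set (u := fix u (k : nat) : nat := match k with
     | O => 1%nat
     | S k' => Nat.max (2 * T0 (u k')) (Nat.max (Z.to_nat (up (/ rho0 (u k')))) (2 ^ S k')) end).
  assert (hu2 : forall k, (2 ^ k <= u k)%nat).
  { destruct k as [|k]; [simpl; lia|]. change (2 ^ S k <= Nat.max (2 * T0 (u k))
     (Nat.max (Z.to_nat (up (/ rho0 (u k)))) (2 ^ S k)))%nat. lia. }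
  assert (hu1 : forall k, (1 <= u k)%nat).
  { intros k; specialize (hu2 k). assert (2 ^ k <> 0)%nat by (apply Nat.pow_nonzero; lia). lia. }
  set (T := fun k => T0 (u k)). set (rho := fun k => rho0 (u k)). set (L := fun k => snd (F (u k))).
  assert (hT2 : forall k, (2 * T k <= T (S k))%nat).
  { intros k. destruct (hF _ (hu1 (S k))) as [h _]. eapply Nat.le_trans; [|exact h].
    change (2 * T k <= Nat.max (2 * T k)
     (Nat.max (Z.to_nat (up (/ rho0 (u k)))) (2 ^ S k)))%nat. lia. }
  assert (hrho : forall k, 0 < rho k <= / INR (u k)) by (intros k; apply (hF _ (hu1 k))).
  assert (hTrho : forall k, INR (T k) * rho k ^ d = 1) by (intros k; apply (hF _ (hu1 k))).
  assert (hrhoS : forall k, rho (S k) <= rho k).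
  { intros k. eapply Rle_trans; [apply hrho|].
    rewrite <- (Rinv_inv (rho k)).
    assert (0 < / rho k) by (apply Rinv_0_lt_compat, hrho).
    apply Rinv_le_contravar; auto.
    assert (h : (Z.to_nat (up (/ rho k)) <= u (S k))%nat).
    { change (Z.to_nat (up (/ rho k)) <= Nat.max (2 * T k)
     (Nat.max (Z.to_nat (up (/ rho k))) (2 ^ S k)))%nat. lia. }
    apply le_INR in h. eapply Rle_trans; [|exact h].
    destruct (archimed (/ rho k)) as [h1 _].
    rewrite INR_IZR_INZ, Z2Nat.id; [lra|]. apply le_IZR. lra. }
  assert (hmono : forall j k, (j <= k)%nat -> rho k <= rho j).
  { induction 1; [lra|]. eapply Rle_trans; [apply hrhoS|auto]. }
  assert (hTge : forall k, (2 ^ k <= T k)%nat).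
  { intros k. destruct (hF _ (hu1 k)) as [h _]. eapply Nat.le_trans; [apply hu2|exact h]. }
  assert (hTk : forall k, (k <= T k)%nat).
  { intros k. specialize (hTge k). pose proof (Nat.pow_gt_lin_r 2 k ltac:(lia)). lia. }
  assert (hTinc : forall j k, (j <= k)%nat -> (T j <= T k)%nat).
  { induction 1 as [|k _ IH]; [lia|]. specialize (hT2 k). lia. }
  assert (hrho2 : forall k, rho k <= / 2 ^ k).
  { intros k. eapply Rle_trans; [apply hrho|]. apply Rinv_le_contravar; [apply pow_lt; lra|].
    specialize (hu2 k). apply le_INR in hu2. rewrite pow_INR in hu2. simpl in hu2.
    replace (1 + 1) with 2 in hu2 by ring. exact hu2. }
  destruct (exists_block_index T hTk) as [idx hidx].
  assert (hidxS : forall n, (idx n <= idx (S n))%nat).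
  { intros n. destruct (hidx n) as [_ h1]; destruct (hidx (S n)) as [h2 _].
    destruct (le_lt_dec (idx n) (idx (S n))) as [h|h]; auto. specialize (h1 _ h); lia. }
  set (r := fun n => rho (idx n)).
  assert (hidxK : forall n K, (T K < n)%nat -> (K < idx n)%nat).
  { intros n K hn. destruct (hidx n) as [h1 _].
    destruct (le_lt_dec (idx n) K) as [h|h]; auto. specialize (hTinc _ _ h); lia. }
  assert (hr : in_Pd d r).
  { split; [|split].
    - intros n _. apply hmono, hidxS.
    - intros e he. destruct (pow_lt_1_zero (1/2) ltac:(rewrite Rabs_right; lra) e he) as [K hK].
      specialize (hK K (le_n _)). rewrite Rabs_right in hK by (apply Rle_ge, pow_le; lra).
      exists (S (T K)). intros n hn. unfold Rdist. rewrite Rminus_0_r, Rabs_right by (apply Rle_ge, Rlt_le, hrho).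
      specialize (hidxK n K ltac:(lia)). unfold r.
      eapply Rle_lt_trans; [apply (hmono K); lia|]. eapply Rle_lt_trans; [apply hrho2|].
      replace (1/2) with (/2) in hK by lra. rewrite pow_inv in hK. exact hK.
    - assert (hpos : forall n, 0 <= r n ^ d) by (intros n; apply pow_le, Rlt_le, hrho).
      (* As [T (S k)] is at least twice [T k], the new indices of block [S k] contribute at least
         half of [T (S k) * rho (S k) ^ d = 1]. *)
      assert (hb : forall k, INR k / 2 <= psum1 (fun n => r n ^ d) (T k)).
      { induction k as [|k IH].
        - simpl INR. replace (0 / 2) with 0 by lra.
          pose proof (psum1_mono (fun n => r n ^ d) 0 (T 0%nat) (fun n _ => hpos n) ltac:(lia)) as h.
          exact h.
        - rewrite (psum1_const_block _ (rho (S k) ^ d) (T k)).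
          + rewrite S_INR, minus_INR by (apply hTinc; lia).
            specialize (hTrho (S k)). specialize (hT2 k). apply le_INR in hT2.
            rewrite mult_INR in hT2. simpl (INR 2) in hT2.
            assert (0 < rho (S k) ^ d) by (apply pow_lt, hrho). nra.
          + apply hTinc; lia.
          + intros n hn. unfold r. replace (idx n) with (S k); auto.
            specialize (hidxK n k ltac:(lia)). destruct (hidx n) as [_ h].
            destruct (le_lt_dec (idx n) (S k)) as [h'|h']; [lia|]. specialize (h _ h'); lia. }
      intros M. destruct (INR_unbounded (2 * M)) as [k hk].
      exists (T k). specialize (hb k). lra. }
  specialize (heut r hr).
  set (E := fun y => forall M : nat, exists n : nat,
    (M <= n)%nat /\ (1 <= n)%nat /\ N (vsub y (vfrac (vscal (INR n) x))) < r n).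
  assert (hE : leb_null d E).
  { intros eps heps.
    destruct (pow_lt_1_zero (1/2) ltac:(rewrite Rabs_right; lra) (eps / (2 * K0))) as [K hK].
    { apply Rdiv_lt_0_compat; lra. }
    specialize (hK K (le_n _)). rewrite Rabs_right in hK by (apply Rle_ge, pow_le; lra).
    replace (1/2) with (/2) in hK by lra. rewrite pow_inv in hK.
    (* The lists from [K] on have total volume at most the geometric sum [2 * K0 / 2 ^ K], which is
       below [eps]. *)
    destruct (cover_of_lists d (fun m => L (K + m)%nat) eps hd) as [a [b [h1 [h2 h3]]]].
    - intros m B hB. apply (hF _ (hu1 (K + m)%nat)); auto.
    - intros K'. apply Rle_trans with (psum1 (fun k => (2 * K0 * / 2 ^ K) * / 2 ^ k) K').
      + assert (hL : forall m, lsum (bvol d) (L m) <= K0 * / 2 ^ m).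
        { intros m. destruct (hF _ (hu1 m)) as [_ [_ [_ [_ [h _]]]]].
          eapply Rle_trans; [exact h|]. apply Rmult_le_compat_l; [lra|].
          apply Rinv_le_contravar; [apply pow_lt; lra|].
          specialize (hu2 m). apply le_INR in hu2. rewrite pow_INR in hu2. simpl in hu2.
          replace (1 + 1) with 2 in hu2 by ring. exact hu2. }
        clear -hL hK0. induction K' as [|K' IH]; simpl; [lra|].
        apply Rplus_le_compat; [exact IH|]. eapply Rle_trans; [apply hL|].
        rewrite pow_add. apply Req_le. field. split; apply pow_nonzero; lra.
      + rewrite psum1_scal, psum1_half_pow.
        assert (0 < / 2 ^ K') by (apply Rinv_0_lt_compat, pow_lt; lra).
        assert (0 < / 2 ^ K) by (apply Rinv_0_lt_compat, pow_lt; lra).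
        apply (Rmult_lt_compat_l (2 * K0)) in hK; [|lra].
        replace (2 * K0 * (eps / (2 * K0))) with eps in hK by (field; lra).
        assert (0 < 2 * K0 * / 2 ^ K) by (apply Rmult_lt_0_compat; lra).
        nra.
    - exists a, b. split; [auto|split; [auto|]].
      intros y hy. destruct (hy (S (T K))) as [n [hn1 [hn2 hn3]]].
      specialize (hidxK n K hn1).
      destruct (hF _ (hu1 (idx n))) as [_ [_ [_ [_ [_ h]]]]].
      destruct (h y n) as [B [hB1 hB2]].
      + split; auto. apply hidx.
      + exact hn3.
      + apply (h3 y (idx n - K)%nat B); auto.
        replace (K + (idx n - K))%nat with (idx n) by lia. exact hB1. }
  (* Eutaxy makes the part of the cube outside [E] null, and [E] is null by construction. *)
  apply (unit_cube_not_null d).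
  apply (leb_null_incl d _ (fun y => (unit_cube d y /\ ~ E y) \/ E y)).
  - intros y hy. destruct (classic (E y)); tauto.
  - apply leb_null_union; auto.
Qed.

(** * Badly approximable points *)

Lemma pow2_INR (n : nat) : INR (2 ^ n) = 2 ^ n.
Proof. rewrite pow_INR. f_equal. Qed.

Lemma pow2_pos (n : nat) : 0 < 2 ^ n.
Proof. apply pow_lt; lra. Qed.

Lemma pow_lt_compat (a b : R) (d : nat) : (1 <= d)%nat -> 0 < a < b -> a ^ d < b ^ d.
Proof.
  intros hd [ha hab]. induction hd as [|d _ IH]; [simpl; lra|].
  simpl. assert (0 < a ^ d) by (apply pow_lt; auto). apply Rmult_gt_0_lt_compat; lra.
Qed.

(** Dyadic form of bad approximability: [q <= 2 ^ (d * k)] gives [q ^ (1 / d) <= 2 ^ k], and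
    multiplying the inequality by [q] removes the real exponent. *)
Lemma bad_approx_separation (d : nat) (x : vec) : (1 <= d)%nat -> bad_approx d x ->
  exists eps, 0 < eps /\ forall (k q : nat) (p : nat -> Z), (1 <= q <= 2 ^ (d * k))%nat ->
    exists i, (i < d)%nat /\ eps / 2 ^ k <= Rabs (INR q * x i - IZR (p i)).
Proof.
  intros hd [eps [he H]]. exists eps; split; auto. intros k q p [hq1 hq2].
  assert (hq : 1 <= INR q) by (apply (le_INR 1); auto).
  assert (hd0 : 0 < INR d) by (apply lt_0_INR; lia).
  pose proof (pow2_pos k) as hk.
  assert (ht : Rpower (INR q) (1 / INR d) <= 2 ^ k).
  { apply Rnot_lt_le; intros h.
    assert (h2 : (2 ^ k) ^ d < Rpower (INR q) (1 / INR d) ^ d).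
    { apply pow_lt_compat; auto; lra. }
    rewrite Rpower_inv_pow in h2 by (auto; lra). rewrite <- pow_mult, Nat.mul_comm in h2.
    apply le_INR in hq2. rewrite pow2_INR in hq2. lra. }
  specialize (H p q hq1). rewrite Rpower_succ in H by lra.
  assert (ht0 : 0 < Rpower (INR q) (1 / INR d)) by apply exp_pos.
  apply supnorm_ge in H; [|apply Rdiv_lt_0_compat; nra]. destruct H as [i [hi1 hi2]].
  exists i; split; auto. unfold vsub in hi2.
  replace (INR q * x i - IZR (p i)) with (INR q * (x i - IZR (p i) / INR q)) by (field; lra).
  rewrite Rabs_mult, (Rabs_right (INR q)) by lra.
  apply Rle_trans with (INR q * (eps / (INR q * Rpower (INR q) (1 / INR d)))).
  - replace (INR q * (eps / (INR q * Rpower (INR q) (1 / INR d))))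
      with (eps / Rpower (INR q) (1 / INR d)) by (field; lra).
    apply Rmult_le_compat_l; [lra|]. apply Rinv_le_contravar; auto.
  - apply Rmult_le_compat_l; lra.
Qed.

(** Labels matter only on the first [d] coordinates, so each is replaced by a chosen representative
    in [digits G d]. Without a coincidence these would be [a] distinct entries of a list of length
    [G ^ d]. *)
Lemma pigeonhole_digits (d G a : nat) (f : nat -> nat -> nat) :
  (forall m i, (m < a)%nat -> (i < d)%nat -> (f m i < G)%nat) -> (G ^ d < a)%nat ->
  exists m m', (m < m' < a)%nat /\ forall i, (i < d)%nat -> f m i = f m' i.
Proof.
  intros hf ha.
  assert (hg : forall m, exists g, (m < a)%nat -> In g (digits G d) /\ forall i, (i < d)%nat -> g i = f m i).
  { intros m. destruct (le_lt_dec a m) as [h|h]; [exists (fun _ => 0%nat); lia|].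
    destruct (digits_spec G d (f m)) as [g hg]; [auto|]. exists g; auto. }
  apply choice in hg; destruct hg as [g hg].
  apply NNPP; intros hno.
  assert (hnd : NoDup (map g (seq 0 a))).
  { apply (proj2 (NoDup_nth _ (g 0%nat))). rewrite length_map, length_seq.
    intros i j hi hj. rewrite !map_nth, !seq_nth by auto. simpl. intros hij.
    apply NNPP; intros hne. apply hno.
    destruct (hg i hi) as [_ h1]; destruct (hg j hj) as [_ h2].
    destruct (le_lt_dec i j) as [h|h]; [exists i, j|exists j, i];
      (split; [lia|intros c hc; rewrite <- h1, <- h2, hij; auto]). }
  apply NoDup_incl_length with (l' := digits G d) in hnd.
  - rewrite length_map, length_seq, digits_length in hnd. lia.
  - intros h hh. apply in_map_iff in hh. destruct hh as [m [<- hm]]. apply in_seq in hm.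
    apply hg; lia.
Qed.

Lemma Int_part_frac (G : nat) (t : R) : (1 <= G)%nat ->
  let m := Z.to_nat (Int_part (INR G * frac_part t)) in
  (m < G)%nat /\ INR m <= INR G * frac_part t < INR m + 1.
Proof.
  intros hG m. apply (le_INR 1) in hG. simpl in hG. destruct (base_fp t) as [h1 h2].
  destruct (base_Int_part (INR G * frac_part t)) as [h3 h4].
  assert (h5 : (0 <= Int_part (INR G * frac_part t))%Z).
  { assert (-1 < IZR (Int_part (INR G * frac_part t))) by nra. apply lt_IZR in H. lia. }
  assert (h6 : INR m = IZR (Int_part (INR G * frac_part t))).
  { unfold m. rewrite INR_IZR_INZ, Z2Nat.id; auto. }
  split; [|lra]. apply INR_lt. rewrite h6. nra.
Qed.

(* The separation bound makes the [2 ^ (d k)] points [i y + n x], [i] fixed, lie in different cells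
   of the grid of mesh [1 / (g 2 ^ k)]; letting [i] take [g ^ d + 1] values forces a coincidence
   between two different values of [i]. *)
Lemma multiple_near_orbit (d : nat) (x : vec) (eps : R) (g : nat) :
  (1 <= g)%nat -> / INR g <= eps ->
  (forall (k q : nat) (p : nat -> Z), (1 <= q <= 2 ^ (d * k))%nat ->
    exists i, (i < d)%nat /\ eps / 2 ^ k <= Rabs (INR q * x i - IZR (p i))) ->
  forall (k : nat) (y : vec), exists (j : nat) (v : Z) (p : nat -> Z),
    (1 <= j <= g ^ d)%nat /\ (Z.abs v <= Z.of_nat (2 ^ (d * k)))%Z /\
    forall c, (c < d)%nat -> Rabs (INR j * y c - IZR v * x c - IZR (p c)) < / (INR g * 2 ^ k).
Proof.
  intros hg hge hsep k y.
  set (T := (2 ^ (d * k))%nat). set (G := (g * 2 ^ k)%nat).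
  assert (hT : (1 <= T)%nat) by (apply Nat.neq_0_lt_0, Nat.pow_nonzero; lia).
  assert (h2k : (1 <= 2 ^ k)%nat) by (apply Nat.neq_0_lt_0, Nat.pow_nonzero; lia).
  assert (hG : (1 <= G)%nat) by (unfold G; nia).
  (* One index [m] encodes the pair [(i, n)] as quotient and remainder modulo [T]: there are
     [(g ^ d + 1) * T] points for [G ^ d = g ^ d * T] grid cells. *)
  set (t := fun m c => INR (m / T) * y c + INR (m mod T) * x c).
  destruct (pigeonhole_digits d G ((g ^ d + 1) * T)
    (fun m c => Z.to_nat (Int_part (INR G * frac_part (t m c))))) as [m [m' [hmm hf]]].
  { intros m i _ _. apply Int_part_frac; auto. }
  { unfold G. rewrite Nat.pow_mul_l, <- Nat.pow_mul_r, (Nat.mul_comm k d). fold T. nia. }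
  assert (hGR : INR G = INR g * 2 ^ k) by (unfold G; rewrite mult_INR, pow2_INR; auto).
  assert (hG1 : 1 <= INR G) by (apply (le_INR 1); auto).
  assert (hg1 : 1 <= INR g) by (apply (le_INR 1); auto).
  set (p := fun c => (Int_part (t m' c) - Int_part (t m c))%Z).
  assert (hclose : forall c, (c < d)%nat -> Rabs (t m' c - t m c - IZR (p c)) < / (INR g * 2 ^ k)).
  { intros c hc. specialize (hf c hc). cbv beta in hf.
    destruct (Int_part_frac G (t m c) hG) as [_ h1].
    destruct (Int_part_frac G (t m' c) hG) as [_ h2].
    rewrite <- hf in h2. rewrite <- hGR.
    replace (t m' c - t m c - IZR (p c)) with (frac_part (t m' c) - frac_part (t m c)).
    2:{ unfold p, frac_part; rewrite minus_IZR; ring. }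
    apply Rmult_lt_reg_l with (INR G); [lra|]. rewrite Rinv_r by lra.
    rewrite <- (Rabs_right (INR G)) at 1 by lra. rewrite <- Rabs_mult.
    apply Rabs_def1; lra. }
  assert (hmT : (m mod T < T)%nat) by (apply Nat.mod_upper_bound; lia).
  assert (hmT' : (m' mod T < T)%nat) by (apply Nat.mod_upper_bound; lia).
  pose proof (Nat.div_mod_eq m T) as hdm. pose proof (Nat.div_mod_eq m' T) as hdm'.
  assert (hi : (m / T <= m' / T)%nat) by (apply Nat.Div0.div_le_mono; lia).
  assert (hi' : (m' / T < g ^ d + 1)%nat) by (apply Nat.Div0.div_lt_upper_bound; lia).
  assert (htt : forall c, t m' c - t m c
     = INR (m' / T - m / T) * y c - IZR (Z.of_nat (m mod T) - Z.of_nat (m' mod T)) * x c).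
  { intros c. unfold t. rewrite minus_INR, minus_IZR, <- !INR_IZR_INZ by auto. ring. }
  exists (m' / T - m / T)%nat, (Z.of_nat (m mod T) - Z.of_nat (m' mod T))%Z, p.
  split; [|split].
  (* Equal quotients would leave [q x] with [1 <= q < T] within [1 / (g * 2 ^ k) <= eps / 2 ^ k] of
     an integer vector, against the separation. *)
  - split; [|lia]. destruct (Nat.eq_dec (m / T) (m' / T)) as [he|he]; [|lia]. exfalso.
    rewrite <- he in hdm'.
    destruct (hsep k (m' mod T - m mod T)%nat p) as [i [hi1 hi2]]; [fold T; lia|].
    specialize (hclose i hi1). rewrite htt, <- he, Nat.sub_diag, minus_IZR, <- !INR_IZR_INZ in hclose.
    rewrite minus_INR in hi2 by lia. simpl (INR 0) in hclose.
    replace (0 * y i - (INR (m mod T) - INR (m' mod T)) * x i - IZR (p i))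
      with ((INR (m' mod T) - INR (m mod T)) * x i - IZR (p i)) in hclose by ring.
    pose proof (pow2_pos k).
    assert (/ (INR g * 2 ^ k) <= eps / 2 ^ k); [|lra].
    rewrite Rinv_mult. apply Rmult_le_compat_r; auto. apply Rlt_le, Rinv_0_lt_compat; auto.
  - fold T. lia.
  - intros c hc. rewrite <- htt. apply hclose; auto.
Qed.

Lemma divide_fact (J j : nat) : (1 <= j <= J)%nat -> exists w, (1 <= w)%nat /\ fact J = (w * j)%nat.
Proof.
  induction J as [|J IH]; intros h; [lia|]. pose proof (lt_O_fact J).
  destruct (Nat.eq_dec j (S J)) as [->|hne].
  - exists (fact J); split; [lia|]. simpl; lia.
  - destruct IH as [w [hw1 hw2]]; [lia|]. exists (S J * w)%nat. split; [nia|].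
    change (fact (S J)) with (S J * fact J)%nat. rewrite hw2. lia.
Qed.

(* Apply the previous lemma to [z / (g ^ d)!] and clear the multiplier [j <= g ^ d]. *)
Lemma orbit_dense (d : nat) (x : vec) : (1 <= d)%nat -> bad_approx d x ->
  exists A : nat, (1 <= A)%nat /\ forall (k M : nat) (z : vec), exists (n : nat) (p : nat -> Z),
    (M <= n <= M + A * 2 ^ (d * k))%nat /\
    forall c, (c < d)%nat -> Rabs (z c - INR n * x c - IZR (p c)) < / 2 ^ S k.
Proof.
  intros hd hbad.
  destruct (bad_approx_separation d x hd hbad) as [eps [heps hsep]].
  destruct (archimed_cor1 eps heps) as [g [hg1 hg2]].
  set (F := fact (g ^ d)). assert (hF : (1 <= F)%nat) by apply lt_O_fact.
  (* Clearing [j] multiplies the error by [w <= F]; working [h] levels deeper, with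
     [2 * F <= 2 ^ h], brings it back below [1 / 2 ^ (k + 1)]. *)
  set (h := (2 * F)%nat).
  assert (hh : (2 * F <= 2 ^ h)%nat) by (apply Nat.lt_le_incl, Nat.pow_gt_lin_r; lia).
  assert (hp2 : forall n, (1 <= 2 ^ n)%nat) by (intros; apply Nat.neq_0_lt_0, Nat.pow_nonzero; lia).
  exists (2 * F * 2 ^ (d * h))%nat. split; [specialize (hp2 (d * h)%nat); nia|].
  intros k M z.
  set (T := (2 ^ (d * (k + h)))%nat).
  assert (hT : (2 * F * 2 ^ (d * h) * 2 ^ (d * k) = 2 * (F * T))%nat).
  { unfold T. rewrite Nat.mul_add_distr_l, Nat.pow_add_r. ring. }
  assert (hFR : 1 <= INR F) by (apply (le_INR 1); auto).
  (* The shift by [F * T + M] turns the possibly negative [w * v], at most [F * T] in absolute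
     value, into an index between [M] and [M + 2 * F * T]. *)
  destruct (multiple_near_orbit d x eps g ltac:(lia) ltac:(lra) hsep (k + h)
    (fun c => (z c - INR (F * T + M) * x c) / INR F)) as [j [v [p [hj [hv hjp]]]]].
  fold T in hv.
  destruct (divide_fact (g ^ d) j hj) as [w [hw1 hw2]]. fold F in hw2.
  assert (hwF : (w <= F)%nat) by nia.
  assert (hwv : (Z.abs (Z.of_nat w * v) <= Z.of_nat (F * T))%Z).
  { rewrite Z.abs_mul, Nat2Z.inj_mul, (Z.abs_eq (Z.of_nat w)) by lia.
    apply Z.mul_le_mono_nonneg; lia. }
  exists (Z.to_nat (Z.of_nat w * v + Z.of_nat (F * T + M))), (fun c => (Z.of_nat w * p c)%Z).
  split; [rewrite hT; lia|].
  intros c hc. specialize (hjp c hc). cbv beta in hjp.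
  assert (hwR : 1 <= INR w) by (apply (le_INR 1); auto).
  assert (hgR : 1 <= INR g) by (apply (le_INR 1); lia).
  assert (hjw : INR F = INR w * INR j) by (rewrite <- mult_INR; f_equal; auto).
  rewrite INR_IZR_INZ, Z2Nat.id, plus_IZR, !mult_IZR, <- !INR_IZR_INZ by lia.
  replace (z c - (INR w * IZR v + INR (F * T + M)) * x c - INR w * IZR (p c)) with
    (INR w * (INR j * ((z c - INR (F * T + M) * x c) / INR F) - IZR v * x c - IZR (p c))).
  2:{ replace (INR w * (INR j * ((z c - INR (F * T + M) * x c) / INR F) - IZR v * x c - IZR (p c)))
        with (INR w * INR j * ((z c - INR (F * T + M) * x c) / INR F)
          - INR w * IZR v * x c - INR w * IZR (p c)) by ring.
      rewrite <- hjw. field. lra. }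
  rewrite Rabs_mult, (Rabs_right (INR w)) by lra.
  apply Rlt_le_trans with (INR w * / (INR g * 2 ^ (k + h))).
  - apply Rmult_lt_compat_l; lra.
  - apply le_INR in hwF. apply le_INR in hh. rewrite mult_INR, pow2_INR in hh. simpl (INR 2) in hh.
    pose proof (pow2_pos k); pose proof (pow2_pos h). rewrite pow_add.
    apply Rmult_le_reg_r with (INR g * (2 ^ k * 2 ^ h)); [apply Rmult_lt_0_compat; nra|].
    rewrite Rmult_assoc, Rinv_l by (apply Rgt_not_eq, Rmult_lt_0_compat; nra).
    simpl. replace (/ (2 * 2 ^ k) * (INR g * (2 ^ k * 2 ^ h))) with (INR g * 2 ^ h / 2) by (field; lra).
    nra.
Qed.

(** * Dyadic cells and the orbit *)

Lemma frac_part_shift (t : R) (p : Z) : 0 <= t + IZR p < 1 -> frac_part t = t + IZR p.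
Proof.
  intros h. destruct (base_fp t) as [h1 h2]. unfold frac_part in *.
  assert (h3 : -1 < IZR (p + Int_part t)) by (rewrite plus_IZR; lra).
  assert (h4 : IZR (p + Int_part t) < 1) by (rewrite plus_IZR; lra).
  apply lt_IZR in h3; apply lt_IZR in h4.
  assert (h5 : (p + Int_part t)%Z = 0%Z) by lia.
  apply (f_equal IZR) in h5. rewrite plus_IZR in h5. lra.
Qed.

(* A dyadic cell of the unit cube: its level and the integer coordinates of its lower corner. *)
Definition cell := (nat * (nat -> nat))%type.
Definition wf_cell (d : nat) (Q : cell) : Prop := forall i, (i < d)%nat -> (snd Q i < 2 ^ fst Q)%nat.
Definition in_cell (d : nat) (Q : cell) (y : vec) : Prop :=
  forall i, (i < d)%nat -> INR (snd Q i) <= 2 ^ fst Q * y i < INR (snd Q i) + 1.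

(** Density is applied to the centre of the cell with error below half its side: the translate of
    [n x] found there is inside the cell, hence in the unit cube, so its coordinates are the
    fractional parts. *)
Lemma orbit_meets_cells (d : nat) (x : vec) : (1 <= d)%nat -> bad_approx d x ->
  exists A : nat, (1 <= A)%nat /\ forall (M : nat) (Q : cell), wf_cell d Q ->
    exists n, (M <= n <= M + A * 2 ^ (d * fst Q))%nat /\ in_cell d Q (vfrac (vscal (INR n) x)).
Proof.
  intros hd hbad. destruct (orbit_dense d x hd hbad) as [A [hA H]].
  exists A; split; auto. intros M [k a] hQ. unfold wf_cell in hQ; simpl in *.
  destruct (H k M (fun c => (INR (a c) + / 2) / 2 ^ k)) as [n [p [hn hp]]].
  exists n; split; auto. intros c hc; simpl. specialize (hp c hc). specialize (hQ c hc).
  pose proof (pow2_pos k) as hk.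
  apply Rabs_def2 in hp. cbn [pow] in hp. unfold vfrac, vscal.
  set (s := INR n * x c + IZR (p c)) in *.
  assert (h1 : (INR (a c) + / 2) / 2 ^ k * 2 ^ k = INR (a c) + / 2) by (field; lra).
  assert (h2 : / (2 * 2 ^ k) * 2 ^ k = / 2) by (field; lra).
  assert (hs : INR (a c) < 2 ^ k * s < INR (a c) + 1) by (unfold s; nra).
  assert (ha : INR (a c) + 1 <= 2 ^ k) by (rewrite <- S_INR, <- pow2_INR; apply le_INR; lia).
  pose proof (pos_INR (a c)).
  rewrite (frac_part_shift _ (p c)); fold s; [lra|]. split; nra.
Qed.

Definition cmass (d : nat) (Q : cell) : R := / (2 ^ d) ^ fst Q.
(** Summed over a list this is the mass on levels at least [n], so the difference for [k] and [S k]
    is the mass sitting exactly at level [k]. *)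
Definition tail (n : nat) (d : nat) (Q : cell) : R := if le_dec n (fst Q) then cmass d Q else 0.

Lemma tail_le (d n : nat) (Q : cell) : (n <= fst Q)%nat -> tail n d Q = cmass d Q.
Proof. intros h; unfold tail; destruct le_dec; auto; lia. Qed.

Lemma tail_gt (d n : nat) (Q : cell) : (fst Q < n)%nat -> tail n d Q = 0.
Proof. intros h; unfold tail; destruct le_dec; auto; lia. Qed.

Lemma lsum_ext {A} (f g : A -> R) L : (forall a, In a L -> f a = g a) -> lsum f L = lsum g L.
Proof.
  induction L as [|a L IH]; intros h; [reflexivity|].
  rewrite !lsum_cons, IH by (intros; apply h; right; auto). rewrite (h a) by (left; auto). auto.
Qed.

Lemma tail_all (d n : nat) (L : list cell) :
  (forall Q, In Q L -> (n <= fst Q)%nat) -> lsum (tail n d) L = lsum (cmass d) L.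
Proof.
  intros h; apply lsum_ext; intros Q hQ; apply tail_le; auto.
Qed.

Lemma tail_none (d n : nat) (L : list cell) :
  (forall Q, In Q L -> (fst Q < n)%nat) -> lsum (tail n d) L = 0.
Proof.
  intros h. rewrite (lsum_const _ 0); [ring|]. intros Q hQ; apply tail_gt; auto.
Qed.

(* Walk down the tree of dyadic cells towards [z] and keep the siblings met on the way. *)
Lemma cells_avoiding (d : nat) (z : vec) (i : nat) : (1 <= d)%nat -> forall Q, wf_cell d Q ->
  in_cell d Q z -> exists L : list cell,
    (forall P, In P L -> wf_cell d P /\ (S (fst Q) <= fst P)%nat) /\
    lsum (cmass d) L = / (2 ^ d) ^ fst Q - / (2 ^ d) ^ (fst Q + i) /\
    (forall n, (S (fst Q) <= n)%nat -> 2 ^ d * lsum (tail (S n) d) L <= lsum (tail n d) L) /\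
    forall y, in_cell d Q y ->
      (exists P, In P L /\ in_cell d P y) \/
      (forall c, (c < d)%nat -> Rabs (y c - z c) < / 2 ^ (fst Q + i)).
Proof.
  intros hd. pose proof (pow2_pos d) as hD0.
  assert (hDp : forall n, 0 < (2 ^ d) ^ n) by (intros; apply pow_lt; auto).
  induction i as [|i IH]; intros [l a] hQ hz; simpl fst in *.
  - exists []. split; [intros P []|]. split; [rewrite Nat.add_0_r; unfold lsum; simpl; lra|].
    split; [intros n _; unfold lsum; simpl; lra|].
    intros y hy. right. intros c hc. specialize (hz c hc); specialize (hy c hc); simpl in hz, hy.
    rewrite Nat.add_0_r. pose proof (pow2_pos l).
    apply Rmult_lt_reg_l with (2 ^ l); auto. rewrite Rinv_r by lra.
    rewrite <- (Rabs_right (2 ^ l)) at 1 by lra. rewrite <- Rabs_mult. apply Rabs_def1; lra.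
  - set (child := fun f : nat -> nat => (S l, fun c => (2 * a c + f c)%nat) : cell).
    (* The next binary digit of each coordinate of [y], which selects the child containing [y]. *)
    set (beta := fun (y : vec) c => if Rlt_dec (2 ^ S l * y c) (2 * INR (a c) + 1) then 0%nat else 1%nat).
    assert (hchild : forall y f, in_cell d (l, a) y -> (forall c, (c < d)%nat -> f c = beta y c) ->
       in_cell d (child f) y).
    { intros y f hy hf c hc. specialize (hy c hc). simpl in *. rewrite (hf c hc).
      rewrite plus_INR, !plus_INR. simpl (INR 0). unfold beta.
      destruct Rlt_dec; simpl in *; lra. }
    assert (hb2 : forall y c, (c < d)%nat -> (beta y c < 2)%nat).
    { intros y c _; unfold beta; destruct Rlt_dec; lia. }
    destruct (digits_spec 2 d (beta z) (hb2 z)) as [b [hb hbz]].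
    assert (hwf : forall f, In f (digits 2 d) -> wf_cell d (child f)).
    { intros f hf c hc. specialize (hQ c hc). pose proof (digits_lt 2 d f hf c hc).
      simpl in *. lia. }
    destruct (IH (child b) (hwf b hb) (hchild z b hz hbz)) as [L [hL1 [hL2 [hL3 hL4]]]].
    simpl fst in *.
    pose proof (digits_length 2 d) as hlen.
    destruct (in_split b _ hb) as [l1 [l2 hsplit]].
    assert (hin : forall f, In f (l1 ++ l2) -> In f (digits 2 d)).
    { intros f hf. rewrite hsplit. apply in_app_or in hf; apply in_or_app. simpl; tauto. }
    assert (hm : lsum (cmass d) (map child (l1 ++ l2)) = / (2 ^ d) ^ l - / (2 ^ d) ^ S l).
    { rewrite lsum_map, (lsum_const _ (/ (2 ^ d) ^ S l)) by reflexivity.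
      rewrite hsplit in hlen. rewrite length_app in hlen. simpl in hlen.
      replace (length (l1 ++ l2)) with (2 ^ d - 1)%nat by (rewrite length_app; lia).
      rewrite minus_INR by lia. rewrite pow2_INR. simpl. field. specialize (hDp l); lra. }
    exists (map child (l1 ++ l2) ++ L).
    assert (hlev : forall P, In P (map child (l1 ++ l2)) -> fst P = S l).
    { intros P hP. apply in_map_iff in hP; destruct hP as [f [<- _]]; reflexivity. }
    replace (l + S i)%nat with (S l + i)%nat by lia.
    split; [|split; [|split]].
    + intros P hP. apply in_app_or in hP; destruct hP as [hP|hP].
      * rewrite (hlev P hP). split; auto. apply in_map_iff in hP; destruct hP as [f [<- hf]]; auto.
      * destruct (hL1 P hP); split; auto; lia.
    + rewrite lsum_app, hm, hL2. lra.
    + intros n hn. rewrite !lsum_app.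
      rewrite (tail_none d (S n)) by (intros P hP; rewrite (hlev P hP); lia).
      destruct (Nat.eq_dec n (S l)) as [->|hne].
      * rewrite (tail_all d (S (S l)) L) by (intros P hP; apply hL1; auto).
        rewrite (tail_all d (S l) L) by (intros P hP; specialize (hL1 P hP); lia).
        rewrite (tail_all d (S l)) by (intros P hP; rewrite (hlev P hP); lia).
        rewrite hm, hL2. simpl pow. pose proof (hDp l).
        assert (0 < / (2 ^ d) ^ (l + i)) by (apply Rinv_0_lt_compat; auto).
        assert (1 <= 2 ^ d) by (apply pow_R1_Rle; lra).
        rewrite !Rinv_mult.
        assert (h0 : forall t, 2 ^ d * (/ 2 ^ d * t) = t) by (intros t; field; lra).
        rewrite Rplus_0_l, Rmult_minus_distr_l, !h0.
        assert (/ 2 ^ d * / (2 ^ d) ^ (l + i) <= / (2 ^ d) ^ (l + i)); [|lra].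
        apply Rmult_le_reg_l with (2 ^ d); auto. rewrite h0. nra.
      * rewrite (tail_none d n) by (intros P hP; rewrite (hlev P hP); lia).
        rewrite !Rplus_0_l. apply hL3; lia.
    + intros y hy.
      destruct (digits_spec 2 d (beta y) (hb2 y)) as [f [hf hfy]].
      pose proof (hchild y f hy hfy) as hyf.
      rewrite hsplit in hf. apply in_elt_inv in hf. destruct hf as [->|hf].
      * destruct (hL4 y hyf) as [[P [hP1 hP2]]|h]; [left|right; exact h].
        exists P; split; auto. apply in_or_app; auto.
      * left. exists (child f). split; auto. apply in_or_app; left. apply in_map; auto.
Qed.

(** * Loss of mass under refinement *)

(** Cells of level [k] are replaced by the siblings avoiding their point [z], deeper cells are kept.
    The last clause compares differences, which add up over cells; the tail invariant thus passes
    from [C] to [C'] although single kept cells need not satisfy it. *)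
Lemma refine_level (d k i : nat) (A : vec -> Prop) : (1 <= d)%nat ->
  (forall Q, wf_cell d Q -> fst Q = k -> exists z, in_cell d Q z /\
     forall y, A y -> ~ (forall c, (c < d)%nat -> Rabs (y c - z c) < / 2 ^ (k + i))) ->
  forall C : list cell, (forall Q, In Q C -> wf_cell d Q /\ (k <= fst Q)%nat) ->
  exists C' : list cell, (forall Q, In Q C' -> wf_cell d Q /\ (S k <= fst Q)%nat) /\
    (forall y, A y -> (exists Q, In Q C /\ in_cell d Q y) -> exists Q, In Q C' /\ in_cell d Q y) /\
    lsum (cmass d) C' = lsum (cmass d) C - / (2 ^ d) ^ i * (lsum (tail k d) C - lsum (tail (S k) d) C) /\
    forall n, (S k <= n)%nat -> 2 ^ d * lsum (tail (S n) d) C' - lsum (tail n d) C'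
      <= 2 ^ d * lsum (tail (S n) d) C - lsum (tail n d) C.
Proof.
  intros hd hA. pose proof (pow2_pos d) as hD0.
  induction C as [|Q C IH]; intros hC.
  - exists []. split; [intros Q []|]. split; [intros y _ [Q [[] _]]|]. unfold lsum; simpl.
    split; [ring|intros; lra].
  - destruct IH as [C' [h1 [h2 [h3 h4]]]]; [intros; apply hC; right; auto|].
    destruct (hC Q) as [hQ1 hQ2]; [left; auto|].
    destruct (Nat.eq_dec (fst Q) k) as [hk|hk].
    + destruct (hA Q hQ1 hk) as [z [hz1 hz2]].
      destruct (cells_avoiding d z i hd Q hQ1 hz1) as [L [hL1 [hL2 [hL3 hL4]]]].
      rewrite hk in *.
      exists (L ++ C'). split; [|split; [|split]].
      * intros P hP. apply in_app_or in hP; destruct hP; auto.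
      * intros y hy [P [[<-|hP] hyP]].
        -- destruct (hL4 y hyP) as [[P [hP1 hP2]]|h]; [|destruct (hz2 y hy h)].
           exists P; split; auto. apply in_or_app; auto.
        -- destruct (h2 y hy) as [P' [hP1 hP2]]; [eauto|].
           exists P'; split; auto. apply in_or_app; auto.
      * rewrite lsum_app, !lsum_cons, hL2, h3, (tail_le d k Q), (tail_gt d (S k) Q) by lia.
        unfold cmass at 2 4. rewrite hk, pow_add, Rinv_mult. ring.
      * intros n hn. rewrite !lsum_app, !lsum_cons. specialize (h4 n hn). specialize (hL3 n hn).
        rewrite (tail_gt d n Q), (tail_gt d (S n) Q) by lia. lra.
    + exists (Q :: C'). split; [|split; [|split]].
      * intros P [<-|hP]; auto. split; auto; lia.
      * intros y hy [P [[<-|hP] hyP]]; [exists Q; split; simpl; auto|].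
        destruct (h2 y hy) as [P' [hP1 hP2]]; [eauto|]. exists P'; split; simpl; auto.
      * rewrite !lsum_cons, h3, (tail_le d k Q), (tail_le d (S k) Q) by lia. ring.
      * intros n hn. rewrite !lsum_cons. specialize (h4 n hn). lra.
Qed.

(* Stage [k] removes the proportion [2 ^ (- d i_k)] of the mass sitting at level [k], and the
   invariant [2 ^ d * tail (n + 1) <= tail n] guarantees that level [k] carries at least half of the
   total mass; so the mass is multiplied by at most [1 - 2 ^ (- d i_k) / 2]. *)
Lemma iterated_refinement (d : nat) (i : nat -> nat) (A : vec -> Prop) : (1 <= d)%nat ->
  (forall y, A y -> unit_cube d y) ->
  (forall k Q, wf_cell d Q -> fst Q = k -> exists z, in_cell d Q z /\
     forall y, A y -> ~ (forall c, (c < d)%nat -> Rabs (y c - z c) < / 2 ^ (k + i k))) ->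
  forall K, exists C : list cell,
    (forall Q, In Q C -> wf_cell d Q /\ (K <= fst Q)%nat) /\
    (forall y, A y -> exists Q, In Q C /\ in_cell d Q y) /\
    (forall n, (K <= n)%nat -> 2 ^ d * lsum (tail (S n) d) C <= lsum (tail n d) C) /\
    lsum (cmass d) C * (1 + / 2 * psum1 (fun k => / (2 ^ d) ^ i (pred k)) K) <= 1.
Proof.
  intros hd hU hA. pose proof (pow2_pos d) as hD0.
  assert (hD1 : 1 <= 2 ^ d) by (apply pow_R1_Rle; lra).
  assert (hD2 : 2 <= 2 ^ d).
  { destruct d as [|d]; [lia|]. simpl. assert (1 <= 2 ^ d) by (apply pow_R1_Rle; lra). lra. }
  assert (hp : forall n, 0 < / (2 ^ d) ^ n <= 1).
  { intros n. assert (1 <= (2 ^ d) ^ n) by (apply pow_R1_Rle; auto).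
    split; [apply Rinv_0_lt_compat; lra|]. rewrite <- Rinv_1. apply Rinv_le_contravar; lra. }
  induction K as [|K [C [h1 [h2 [h3 h4]]]]].
  - exists [(0%nat, fun _ => 0%nat)]. split; [|split; [|split]].
    + intros Q [<-|[]]. split; [|lia]. intros c _; simpl; lia.
    + intros y hy. exists (0%nat, fun _ => 0%nat). split; [left; auto|].
      intros c hc. specialize (hU y hy c hc). simpl. lra.
    + intros n _. unfold lsum; cbn [map fold_right]. rewrite (tail_gt d (S n)) by (simpl; lia).
      assert (0 <= tail n d (0%nat, fun _ => 0%nat)); [|lra].
      unfold tail; destruct le_dec; [unfold cmass; apply Rlt_le, hp|lra].
    + unfold lsum, cmass; simpl. lra.
  - destruct (refine_level d K (i K) A hd (hA K) C h1) as [C' [g1 [g2 [g3 g4]]]].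
    exists C'. split; [auto|split; [|split]].
    + intros y hy. apply g2; auto.
    + intros n hn. specialize (g4 n hn). specialize (h3 n ltac:(lia)). lra.
    + simpl psum1. set (p := / (2 ^ d) ^ i K) in *.
      assert (hp' : 0 < p <= 1) by apply hp.
      specialize (h3 K (le_n _)).
      rewrite (tail_all d K) in h3, g3 by (intros; apply h1; auto).
      set (W := lsum (cmass d) C) in *. set (W' := lsum (cmass d) C') in *.
      set (S0 := psum1 (fun k => / (2 ^ d) ^ i (pred k)) K) in *.
      assert (hS0 : 0 <= S0).
      { unfold S0. apply (psum1_mono (fun k => / (2 ^ d) ^ i (pred k)) 0 K); [|lia].
        intros; apply Rlt_le, hp. }
      assert (hW0 : 0 <= W).
      { apply lsum_nonneg. intros Q _; unfold cmass; apply Rlt_le, hp. }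
      assert (hT0 : 0 <= lsum (tail (S K) d) C).
      { apply lsum_nonneg. intros Q _; unfold tail; destruct le_dec; [|lra]; unfold cmass; apply Rlt_le, hp. }
      (* All cells have level at least [K], so [tail K] sums to [W]; the invariant with [2 ^ d >= 2]
         leaves at most half of it below level [K]. *)
      assert (hT : lsum (tail (S K) d) C <= W / 2) by nra.
      assert (hW' : W' <= W * (1 - p / 2)) by nra.
      (* From [(1 - p/2) (1 + (S0 + p)/2) <= 1 + S0/2]: bounding the mass by the inverse of one plus
         half the sum avoids infinite products. *)
      apply Rle_trans with (W * (1 - p / 2) * (1 + / 2 * (S0 + p))).
      * apply Rmult_le_compat_r; nra.
      * apply Rle_trans with (W * (1 + / 2 * S0)); [|auto].
        rewrite Rmult_assoc. apply Rmult_le_compat_l; auto. nra.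
Qed.

(** * Divergence of the removed proportions *)

(** Either [g] equals 1 infinitely often and its sums diverge by themselves, or [f <= g] from some
    index on. The value 1 stands for a ball that swallows its whole cell, where comparison with the
    radius may fail. *)
Lemma psum1_unbounded_transfer (f g : nat -> R) :
  (forall k, 0 <= f k) -> (forall k, 0 <= g k) -> (forall k, g k = 1 \/ f k <= g k) ->
  (forall B, exists K, B < psum1 f K) -> forall B, exists K, B < psum1 g K.
Proof.
  intros hf hg hfg hunb.
  destruct (classic (forall k0, exists k, (k0 <= k)%nat /\ g k = 1)) as [h|h].
  - assert (hm : forall m : nat, exists K, INR m <= psum1 g K).
    { induction m as [|m [K IH]]; [exists 0%nat; simpl; lra|].
      destruct (h (S K)) as [k [hk1 hk2]]. exists k. rewrite S_INR.
      destruct k as [|k]; [lia|]. simpl. rewrite hk2.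
      pose proof (psum1_mono g K k (fun j _ => hg j) ltac:(lia)). lra. }
    intros B. destruct (INR_unbounded B) as [m hm']. destruct (hm m) as [K hK]. exists K. lra.
  - apply not_all_ex_not in h. destruct h as [k0 h].
    assert (hk0 : forall k, (k0 <= k)%nat -> f k <= g k).
    { intros k hk. destruct (hfg k); auto. destruct h; eauto. }
    assert (hle : forall K, psum1 f K <= psum1 f k0 + psum1 g K).
    { induction K as [|K IH].
      - pose proof (psum1_mono f 0 k0 (fun j _ => hf j) ltac:(lia)). simpl in *; lra.
      - destruct (le_lt_dec k0 (S K)) as [hK|hK].
        + simpl. specialize (hk0 _ hK). lra.
        + pose proof (psum1_mono f (S K) k0 (fun j _ => hf j) ltac:(lia)).
          pose proof (psum1_mono g 0 (S K) (fun j _ => hg j) ltac:(lia)). simpl in *; lra. }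
    intros B. destruct (hunb (psum1 f k0 + B)) as [K hK]. exists K. specialize (hle K). lra.
Qed.

Lemma in_Pd_antitone (d : nat) (r : nat -> R) : in_Pd d r ->
  forall n m, (1 <= n <= m)%nat -> r m <= r n.
Proof.
  intros [h _] n m [hn hm]. induction hm as [|m hm IH]; [lra|].
  specialize (h m ltac:(lia)). lra.
Qed.

(** A decreasing sequence with limit 0 is nonnegative, and a single zero would make all later terms
    vanish and the series converge. *)
Lemma in_Pd_pos (d : nat) (r : nat -> R) : (1 <= d)%nat -> in_Pd d r ->
  forall n, (1 <= n)%nat -> 0 < r n.
Proof.
  intros hd hr. pose proof (in_Pd_antitone d r hr) as hanti. destruct hr as [_ [h2 h3]].
  assert (hge : forall n, (1 <= n)%nat -> 0 <= r n).
  { intros n hn. apply Rnot_lt_le; intros hlt. destruct (h2 (- r n) ltac:(lra)) as [m0 hm0].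
    specialize (hm0 (Nat.max m0 n) ltac:(lia)). specialize (hanti n (Nat.max m0 n) ltac:(lia)).
    unfold Rdist in hm0. apply Rabs_def2 in hm0. lra. }
  intros n hn. apply Rnot_le_lt; intros hle.
  assert (hz : forall m, (n <= m)%nat -> r m = 0).
  { intros m hm. specialize (hanti n m ltac:(lia)). specialize (hge m ltac:(lia)). lra. }
  destruct (h3 (psum1 (fun k => r k ^ d) n)) as [K hK].
  destruct (le_lt_dec n K) as [h|h].
  - rewrite (psum1_const_block _ 0 n K) in hK; [lra|auto|].
    intros m hm. rewrite hz by lia. apply pow_i; lia.
  - pose proof (psum1_mono (fun k => r k ^ d) K n) as h'.
    assert (psum1 (fun k => r k ^ d) K <= psum1 (fun k => r k ^ d) n); [|lra].
    apply h'; [|lia]. intros k hk; apply pow_le, hge; auto.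
Qed.

Lemma psum1_block_le (f : nat -> R) (c : R) (a b : nat) :
  (a <= b)%nat -> (forall n, (a < n <= b)%nat -> f n <= c) ->
  psum1 f b <= psum1 f a + INR (b - a) * c.
Proof.
  induction 1 as [|b hab IH]; intros h; [rewrite Nat.sub_diag; simpl; lra|].
  simpl psum1. specialize (IH ltac:(intros; apply h; lia)). specialize (h (S b) ltac:(lia)).
  rewrite Nat.sub_succ_l by lia. rewrite S_INR. lra.
Qed.

(** Cauchy condensation along [t k = M + A * 2 ^ (d * k)]: between [t k] and [t (k + 1)] there are
    at most [A * 2 ^ d * (2 ^ d) ^ k] indices, with radii at most [r (t k)]. *)
Lemma condensation (d : nat) (r : nat -> R) (M A : nat) : (1 <= d)%nat -> (1 <= M)%nat -> (1 <= A)%nat ->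
  in_Pd d r -> forall B, exists K,
    B < psum1 (fun k => (2 ^ d) ^ pred k * r (M + A * 2 ^ (d * pred k))%nat ^ d) K.
Proof.
  intros hd hM hA hr B. pose proof (pow2_pos d) as hD.
  pose proof (in_Pd_antitone d r hr) as hanti. pose proof (in_Pd_pos d r hd hr) as hpos.
  destruct hr as [_ [_ h3]].
  set (t := fun k => (M + A * 2 ^ (d * k))%nat).
  set (q := fun k => (2 ^ d) ^ k * r (t k) ^ d).
  assert (ht : forall k, (1 <= t k)%nat) by (intros; unfold t; lia).
  assert (hA0 : 1 <= INR A) by (apply (le_INR 1); auto).
  assert (hp : forall k, (2 ^ (d * k) <= 2 ^ (d * S k))%nat) by (intros; apply Nat.pow_le_mono_r; lia).
  assert (hb : forall K, psum1 (fun n => r n ^ d) (t K)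
     <= psum1 (fun n => r n ^ d) (t 0%nat) + INR A * 2 ^ d * psum1 (fun k => q (pred k)) K).
  { induction K as [|K IH]; [simpl; lra|].
    eapply Rle_trans; [apply (psum1_block_le _ (r (t K) ^ d) (t K))|].
    - unfold t. specialize (hp K). nia.
    - intros n hn. specialize (ht K). apply pow_incr. split; [apply Rlt_le, hpos; lia|apply hanti; lia].
    - simpl psum1 at 3. simpl pred.
      assert (h0 : 0 <= r (t K) ^ d) by (apply pow_le, Rlt_le, hpos, ht).
      assert (INR (t (S K) - t K) * r (t K) ^ d <= INR A * 2 ^ d * q K); [|lra].
      unfold q. rewrite <- Rmult_assoc. apply Rmult_le_compat_r; auto.
      apply Rle_trans with (INR (A * 2 ^ (d * S K))); [apply le_INR; unfold t; lia|].
      rewrite mult_INR, pow2_INR, pow_mult. simpl. lra. }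
  destruct (h3 (psum1 (fun n => r n ^ d) (t 0%nat) + INR A * 2 ^ d * B)) as [K hK].
  exists K. change (B < psum1 (fun k => q (pred k)) K).
  apply Rmult_lt_reg_l with (INR A * 2 ^ d); [nra|].
  specialize (hb K).
  assert (psum1 (fun n => r n ^ d) K <= psum1 (fun n => r n ^ d) (t K)); [|lra].
  apply psum1_mono; [intros; apply pow_le, Rlt_le, hpos; auto|].
  unfold t. assert (K <= 2 ^ (d * K))%nat; [|nia].
  apply Nat.le_trans with (2 ^ K)%nat; [apply Nat.lt_le_incl, Nat.pow_gt_lin_r; lia|].
  apply Nat.pow_le_mono_r; nia.
Qed.

(** Coverings use open boxes while cells contain their lower faces, so the box extends one side
    length below the cell; the volume grows by the factor [2 ^ d]. *)
Definition cell_box (Q : cell) : box :=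
  ((fun i => (INR (snd Q i) - 1) / 2 ^ fst Q), (fun i => (INR (snd Q i) + 1) / 2 ^ fst Q)).

Lemma cell_box_wf (d : nat) (Q : cell) : wf_box d (cell_box Q).
Proof.
  intros i _; simpl. pose proof (pow2_pos (fst Q)).
  apply Rmult_le_compat_r; [apply Rlt_le, Rinv_0_lt_compat; auto|lra].
Qed.

Lemma cell_box_vol (d : nat) (Q : cell) : bvol d (cell_box Q) = 2 ^ d * cmass d Q.
Proof.
  unfold bvol, cmass. pose proof (pow2_pos (fst Q)).
  rewrite (box_vol_cube d _ _ (2 * / 2 ^ fst Q)).
  - rewrite Rpow_mult_distr, pow_inv, <- !pow_mult, (Nat.mul_comm d). reflexivity.
  - intros i _; simpl. field. lra.
Qed.

Lemma in_cell_box (d : nat) (Q : cell) (y : vec) :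
  in_cell d Q y -> in_box d (fst (cell_box Q)) (snd (cell_box Q)) y.
Proof.
  intros h i hi. specialize (h i hi). simpl. pose proof (pow2_pos (fst Q)).
  split; apply Rmult_lt_reg_l with (2 ^ fst Q); auto; unfold Rdiv.
  - replace (2 ^ fst Q * ((INR (snd Q i) - 1) * / 2 ^ fst Q)) with (INR (snd Q i) - 1) by (field; lra). lra.
  - replace (2 ^ fst Q * ((INR (snd Q i) + 1) * / 2 ^ fst Q)) with (INR (snd Q i) + 1) by (field; lra). lra.
Qed.

Lemma missed_set_small_cover (d : nat) (hd : (1 <= d)%nat) (N : vec -> R) (hN : is_norm d N) (x : vec)
  (r : nat -> R) (M : nat) : bad_approx d x -> in_Pd d r -> forall eps, 0 < eps ->
  exists L : list box, (forall B, In B L -> wf_box d B) /\ lsum (bvol d) L <= eps /\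
    forall y, unit_cube d y -> (forall n, (S M <= n)%nat -> ~ N (vsub y (vfrac (vscal (INR n) x))) < r n) ->
      exists B, In B L /\ in_box d (fst B) (snd B) y.
Proof.
  intros hbad hr eps heps.
  destruct (norm_upper d N hN) as [C [hC HC]].
  destruct (orbit_meets_cells d x hd hbad) as [A [hA hmeet]].
  pose proof (pow2_pos d) as hD.
  set (A0 := fun y => unit_cube d y /\
    forall n, (S M <= n)%nat -> ~ N (vsub y (vfrac (vscal (INR n) x))) < r n).
  set (R0 := fun k => r (S M + A * 2 ^ (d * k))%nat).
  assert (hR0 : forall k, 0 < R0 k) by (intros; apply (in_Pd_pos d r); auto; lia).
  (* [i k] is the least depth at which the norm constant [C] puts the subcell around an orbit point
     inside the ball of radius [R0 k]. Minimality later bounds the removed proportion from below. *)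
  assert (hi : forall k, exists i, C * / 2 ^ (k + i) <= R0 k /\
     forall j, C * / 2 ^ (k + j) <= R0 k -> (i <= j)%nat).
  { intros k.
    destruct (dec_inh_nat_subset_has_unique_least_element (fun i => C * / 2 ^ (k + i) <= R0 k))
      as [i [hi _]].
    - intros n; apply classic.
    - destruct (pow_lt_1_zero (1/2) ltac:(rewrite Rabs_right; lra) (R0 k / C)) as [i hi].
      { apply Rdiv_lt_0_compat; auto. }
      specialize (hi (k + i)%nat ltac:(lia)). rewrite Rabs_right in hi by (apply Rle_ge, pow_le; lra).
      replace (1/2) with (/2) in hi by lra. rewrite pow_inv in hi. exists i.
      apply (Rmult_lt_compat_l C) in hi; auto.
      replace (C * (R0 k / C)) with (R0 k) in hi by (field; lra). lra.
    - exists i; auto. }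
  apply choice in hi; destruct hi as [i hi].
  assert (hit : forall k Q, wf_cell d Q -> fst Q = k -> exists z, in_cell d Q z /\
     forall y, A0 y -> ~ (forall c, (c < d)%nat -> Rabs (y c - z c) < / 2 ^ (k + i k))).
  { intros k Q hQ hk. destruct (hmeet (S M) Q hQ) as [n [hn1 hn2]]. rewrite hk in hn1.
    exists (vfrac (vscal (INR n) x)); split; auto. intros y [_ hy] hclose.
    apply (hy n); [lia|]. destruct (hi k) as [hik _].
    apply Rlt_le_trans with (R0 k); [|apply (in_Pd_antitone d r hr); lia].
    eapply Rlt_le_trans; [|exact hik]. apply HC; [apply Rinv_0_lt_compat, pow2_pos|].
    intros c hc. apply Rlt_le, hclose; auto. }
  assert (hp0 : forall n, 0 < / (2 ^ d) ^ n) by (intros; apply Rinv_0_lt_compat, pow_lt; auto).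
  assert (hC2 : 0 < (2 * C) ^ d) by (apply pow_lt; lra).
  assert (hdiv : forall B, exists K, B < psum1 (fun k => / (2 ^ d) ^ i (pred k)) K).
  { apply (psum1_unbounded_transfer (fun k => / (2 * C) ^ d * ((2 ^ d) ^ pred k * R0 (pred k) ^ d))).
    - intros k. apply Rmult_le_pos; [apply Rlt_le, Rinv_0_lt_compat; auto|].
      apply Rmult_le_pos; apply pow_le; [lra|apply Rlt_le; auto].
    - intros k; apply Rlt_le; auto.
    - intros k. generalize (pred k); clear k; intros k. destruct (hi k) as [_ hmin].
      (* Depth 0 removes the whole cell. Otherwise depth [j] is too shallow, so
         [R0 k <= C / 2 ^ (k + j)]; the step from [j] to [S j] is the origin of [2 * C]. *)
      destruct (i k) as [|j]; [left; simpl; apply Rinv_1|right].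
      assert (hj : R0 k <= C * / 2 ^ (k + j)).
      { apply Rnot_lt_le; intros h. specialize (hmin j ltac:(lra)). lia. }
      apply (fun h => pow_incr _ _ d (conj (Rlt_le _ _ (hR0 k)) h)) in hj.
      rewrite Rpow_mult_distr, pow_inv, <- pow_mult, Nat.mul_comm, pow_mult, pow_add in hj.
      rewrite Rpow_mult_distr. simpl ((2 ^ d) ^ S j).
      assert (hk : 0 < (2 ^ d) ^ k) by (apply pow_lt; auto).
      assert (hj' : 0 < (2 ^ d) ^ j) by (apply pow_lt; auto).
      assert (hC' : 0 < C ^ d) by (apply pow_lt; auto).
      apply Rle_trans with (/ (2 ^ d * C ^ d) * ((2 ^ d) ^ k * (C ^ d * / ((2 ^ d) ^ k * (2 ^ d) ^ j)))).
      + apply Rmult_le_compat_l; [apply Rlt_le, Rinv_0_lt_compat; nra|].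
        apply Rmult_le_compat_l; lra.
      + apply Req_le. field. repeat split; lra.
    - intros B. destruct (condensation d r (S M) A hd ltac:(lia) hA hr ((2 * C) ^ d * B)) as [K hK].
      exists K. rewrite psum1_scal. apply Rmult_lt_reg_l with ((2 * C) ^ d); auto.
      rewrite <- Rmult_assoc, Rinv_r, Rmult_1_l by lra. exact hK. }
  (* Half of this sum exceeds [2 ^ d / eps], so the mass is at most [eps / 2 ^ d], and [cell_box]
     gives back the factor [2 ^ d]. *)
  destruct (hdiv (2 * (2 ^ d / eps))) as [K hK].
  destruct (iterated_refinement d i A0 hd ltac:(intros y hy; apply hy) hit K) as [Cs [_ [h2 [_ h4]]]].
  exists (map cell_box Cs). split; [|split].
  - intros B hB. apply in_map_iff in hB; destruct hB as [Q [<- _]]. apply cell_box_wf.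
  - rewrite lsum_map, (lsum_ext _ (fun Q => 2 ^ d * cmass d Q)) by (intros; apply cell_box_vol).
    assert (hs : lsum (fun Q => 2 ^ d * cmass d Q) Cs = 2 ^ d * lsum (cmass d) Cs).
    { clear. induction Cs as [|Q Cs IH]; [unfold lsum; simpl; ring|]. rewrite !lsum_cons, IH; ring. }
    rewrite hs.
    assert (hm0 : 0 <= lsum (cmass d) Cs) by (apply lsum_nonneg; intros; apply Rlt_le, hp0).
    assert (h5 : lsum (cmass d) Cs * (2 ^ d / eps) <= 1) by nra.
    apply Rmult_le_reg_r with (/ eps); [apply Rinv_0_lt_compat; auto|].
    rewrite Rinv_r by lra. unfold Rdiv in h5. lra.
  - intros y hy1 hy2. destruct (h2 y (conj hy1 hy2)) as [Q [hQ1 hQ2]].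
    exists (cell_box Q). split; [apply in_map; auto|apply in_cell_box; auto].
Qed.

Lemma bad_approx_eutaxic (d : nat) (hd : (1 <= d)%nat) (N : vec -> R) (hN : is_norm d N) (x : vec) :
  bad_approx d x -> unif_eutaxic d N (fun n => vfrac (vscal (INR n) x)) (unit_cube d).
Proof.
  intros hbad r hr eps heps.
  (* The exceptional set is the union over [M] of the points missed by all balls of index at least
     [S M]; the successor ensures [1 <= n], and the [M]-th piece may cost [eps / 2 ^ (M + 1)]. *)
  assert (hL : forall M, exists L : list box, (forall B, In B L -> wf_box d B) /\
    lsum (bvol d) L <= eps * / 2 ^ S M /\
    forall y, unit_cube d y -> (forall n, (S M <= n)%nat -> ~ N (vsub y (vfrac (vscal (INR n) x))) < r n) ->
      exists B, In B L /\ in_box d (fst B) (snd B) y).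
  { intros M. apply (missed_set_small_cover d hd N hN x r M hbad hr).
    apply Rmult_lt_0_compat; auto. apply Rinv_0_lt_compat, pow2_pos. }
  apply choice in hL; destruct hL as [L hL].
  destruct (cover_of_lists d L eps hd) as [a [b [h1 [h2 h3]]]].
  - intros m B hB. apply (hL m); auto.
  - intros K. apply Rle_trans with (psum1 (fun k => eps * / 2 ^ k) K).
    + rewrite (psum1_ext _ (fun k => lsum (bvol d) (L (pred k)) + 0)) by (intros; ring).
      clear -hL. induction K as [|K IH]; simpl; [lra|].
      destruct (hL K) as [_ [h _]]. simpl in h. lra.
    + rewrite psum1_scal, psum1_half_pow.
      assert (0 < / 2 ^ K) by (apply Rinv_0_lt_compat, pow2_pos). nra.
  - exists a, b. split; [auto|split; [auto|]].
    intros y [hy1 hy2]. apply not_all_ex_not in hy2. destruct hy2 as [M hM].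
    destruct (hL M) as [_ [_ h]]. destruct (h y hy1) as [B [hB1 hB2]].
    + intros n hn hlt. apply hM. exists n. repeat split; auto; lia.
    + apply (h3 y M B); auto.
Qed.

Theorem theorem11p6 (d : nat) (hd : (1 <= d)%nat) (N : vec -> R) (hN : is_norm d N)
  (x : vec) :
  unif_eutaxic d N (fun n => vfrac (vscal (INR n) x)) (unit_cube d) <-> bad_approx d x.
Proof.
  split.
  - apply eutaxic_bad_approx; auto.
  - apply bad_approx_eutaxic; auto.
Qed.
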